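(* For each $\nu\ge1$ let $n=n_\nu\ge1$ be an integer, let $d_1,\dots,d_n$ (depending on $\nu$) be non-negative integers with even sum, let $N=N_\nu=\tfrac12\sum_{i} d_i$, and let $G^*(n,(d_i)_1^n)$ be the random multigraph given by the configuration model. Assume that, as $\nu\to\infty$, $N\to\infty$ and $\max_i d_i=o(N^{1/2})$. Let $$\Lambda=\frac1{2N}\sum_{i=1}^n\binom{d_i}2=\frac{\sum_i d_i^2}{4N}-\frac12.$$ Then, as $\nu\to\infty$, $$\mathbb P\bigl(G^*(n,(d_i)_1^n)\text{ is simple}\bigr)=\exp\bigl(-\Lambda-\Lambda^2\bigr)+o(1)=\exp\Bigl(-\frac14\Bigl(\frac{\sum_i d_i^2}{2N}\Bigr)^2+\frac14\Bigr)+o(1).$$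
   Context: Configuration model: given $n\ge1$ and non-negative integers $d_1,\dots,d_n$ with $\sum_i d_i=2N$ even, take pairwise disjoint sets of half-edges, with $d_v$ half-edges belonging to each vertex $v\in\{1,\dots,n\}$ ($2N$ half-edges in total). A configuration is a partition of the set of all half-edges into $N$ pairs. Choose a configuration uniformly at random; $G^*(n,(d_i)_1^n)$ is the random multigraph with vertex set $\{1,\dots,n\}$ in which each pair $\{x,y\}$ of the configuration, with $x$ belonging to $v$ and $y$ belonging to $w$, gives an edge between $v$ and $w$ (a loop if $v=w$). A multigraph is simple if it has no loops and no multiple edges. *)

(* Defs.v *)
From mathcomp Require Import all_boot all_order all_algebra.
From mathcomp Require Import all_classical all_reals all_analysis.

Set Implicit Arguments.
Unset Strict Implicit.
Unset Printing Implicit Defensive.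

Import Order.TTheory GRing.Theory Num.Theory.
Local Open Scope ring_scope.

(* An edge with one end is a loop; [edge] being an arbitrary finite type,
   several edges may share their ends. *)
Record multigraph (V : finType) := Multigraph {
  edge : finType;
  ends : edge -> {set V};
  card_ends : forall e, (0 < #|ends e| <= 2)%N
}.

Section Simple.
Variables (V : finType) (G : multigraph V).

Definition is_loop (e : edge G) : bool := #|ends e| == 1%N.

Definition parallel (e f : edge G) : bool := (e != f) && (ends e == ends f).

Definition simple_multigraph : bool :=
  [forall e, ~~ is_loop e] && [forall e, forall f, ~~ parallel e f].

End Simple.

Definition uniform_prob (R : realType) (T : finType) (E : pred T) : R :=
  #|E|%:R / #|T|%:R.

Section ConfigurationModel.
Variables (R : realType) (n : nat) (d : 'I_n -> nat).

Definition half_edge : finType := {v : 'I_n & 'I_(d v)}.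

Definition owner (x : half_edge) : 'I_n := tag x.

Definition is_configuration (P : {set {set half_edge}}) : bool :=
  finset.partition P [set: half_edge] && [forall B in P, #|B| == 2%N].

Definition configuration : finType :=
  {P : {set {set half_edge}} | is_configuration P}.

Section Graph.
Variable P : configuration.

Definition config_edge : finType := {B : {set half_edge} | B \in val P}.

(* The pair {x, y} joins the owners of x and y. *)
Definition config_ends (B : config_edge) : {set 'I_n} := owner @: val B.

Lemma card_config_ends (B : config_edge) : (0 < #|config_ends B| <= 2)%N.
Proof.
have /andP[_ /forall_inP/(_ _ (valP B))/eqP cB] := valP P.
apply/andP; split; last by rewrite -cB; exact: leq_imset_card.
have : (0 < #|val B|)%N by rewrite cB.
by rewrite !card_gt0 imset_eq0.
Qed.

Definition config_multigraph : multigraph 'I_n := Multigraph card_config_ends.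

End Graph.

(* The number N of pairs when the degree sum is 2N; the halving is exact only
   for an even degree sum. *)
Definition num_pairs : nat := (\sum_(i < n) d i)./2.

Definition prob_simple : R :=
  uniform_prob R
    [pred P : configuration | simple_multigraph (config_multigraph P)].

Definition Lambda : R :=
  (2 * num_pairs%:R)^-1 * \sum_(i < n) 'C(d i, 2)%:R.

End ConfigurationModel.

(* Main.v *)
Require Import Defs.
From mathcomp Require Import all_boot all_order all_algebra fingroup perm.
From mathcomp Require Import ring lra zify.
From mathcomp Require Import all_classical all_reals all_analysis.

(** A configuration is the same thing as a fixed-point-free involution [s] of
    the set of half-edges, [s x] being the mate of [x] ([card_pairings]).  The
    multigraph is simple exactly when a weight [W s] vanishes
    ([simple_weight]); [W] counts every loop four times, and every pair of
    parallel edges that are not loops four times.  For bounded [Lambda] the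
    number [W / 4] is asymptotically Poisson of mean
    [lam = Lambda + Lambda ^ 2], which is why the probability of simplicity
    is close to [exp (- lam)].

    The Poisson approximation needs first moments only.  Let
    [g t = E (t ^ W)].  Then [g' t = E (W * t ^ (W - 1))] is a sum, over the
    possible loops and double edges [a], of
    [P (a present) * E (t ^ (W - 1) | a present)].  Conditioning on the
    presence of an edge between [x] and [y] is realised by a switch:
    exchanging the roles of [s x] and [y] makes mates of [x] and [y] on the
    one hand, of [s x] and [s y] on the other, and it carries the uniform law
    to the conditional law ([sum_switch], [mean_switch]).  A switch adds to [W]
    the contribution of the structure that it creates, up to the contributions
    of the four edges that it adds or removes ([weight_switch]), and the mean
    of these is small ([mean_local_weight_le], [mean_switch_weight]).  Hence
    [E (t ^ (W - 1) | a present)] is close to [E (t ^ (W + 3))], so that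
    [g' t] is close to [4 * lam * t ^ 3 * g t] ([derivative_bound],
    [total_error_le]).  Since [g 1 = 1], the mean value theorem for
    [g t * exp (- lam * t ^ 4)] shows that [g 0 = P (W = 0)] is close to
    [exp (- lam)] ([interpolation], [poisson_approx]).

    The error is of order [(1 + Lambda) ^ 3 * Delta ^ 2 / N], where [Delta] is
    the maximal degree; it vanishes in the limit only if [Lambda] stays
    bounded.  When [Lambda] is large, both the probability and
    [exp (- Lambda - Lambda ^ 2)] are small, the former by Chebyshev's
    inequality for the number of loops ([prob_weight0_le]).  The lemma
    [prob_simple_approx] puts the two regimes together. *)

Set Implicit Arguments.
Unset Strict Implicit.
Unset Printing Implicit Defensive.

Import Order.TTheory GRing.Theory Num.Theory.
Import numFieldNormedType.Exports.
Local Open Scope ring_scope.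

Lemma eq_ler (R : porderZmodType) (x y : R) : x = y -> x <= y.
Proof. by move=> ->. Qed.

(** * Perfect matchings as involutions, and their conditional means *)

Section Matchings.
Variable T : finType.
Implicit Types (s : {perm T}) (F : seq (T * T)) (x y z w : T).

Definition matching s := [forall x, (s x != x) && (s (s x) == x)].

(** The list [F] of pairs prescribes some of the edges. *)
Definition extends F s := matching s && all (fun e => s e.1 == e.2) F.

Definition ends_of F : seq T := [seq e.1 | e <- F] ++ [seq e.2 | e <- F].

Lemma matchingP s : reflect ((forall x, s x != x) /\ involutive s) (matching s).
Proof.
apply: (iffP forallP) => [h|[h1 h2] x]; last by rewrite h1 h2 eqxx.
by split=> x; have /andP[// ? /eqP] := h x.
Qed.

Lemma extends_nil s : extends [::] s = matching s. Proof. by rewrite /extends andbT. Qed.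

Lemma extends_cons x y F s : extends ((x, y) :: F) s = extends F s && (s x == y).
Proof. by rewrite /extends /=; case: (matching s); case: (s x == y); rewrite ?andbT ?andbF. Qed.

Lemma extends_matching F s : extends F s -> matching s.
Proof. by case/andP. Qed.

Lemma uniq_ends_cons x y F :
  uniq (ends_of ((x, y) :: F)) =
  [&& x != y, x \notin ends_of F, y \notin ends_of F & uniq (ends_of F)].
Proof.
have -> : uniq (ends_of ((x, y) :: F)) = uniq (x :: y :: ends_of F).
  apply: perm_uniq; rewrite /ends_of /= perm_cons.
  by rewrite -[y :: _]cat1s perm_catCA.
by rewrite /= inE negb_or -!andbA.
Qed.

Lemma size_ends F : size (ends_of F) = (size F).*2.
Proof. by rewrite size_cat !size_map addnn. Qed.

Lemma extends_ends F s x : extends F s -> x \in ends_of F -> s x \in ends_of F.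
Proof.
case/andP=> /matchingP[_ sI] /allP sF; rewrite !mem_cat => /orP[] /mapP[e eF ->].
  by rewrite (eqP (sF e eF)) (map_f snd eF) orbT.
by rewrite -(eqP (sF e eF)) sI (map_f fst eF).
Qed.

Lemma extends_out F s x : extends F s -> x \notin ends_of F -> s x \notin ends_of F.
Proof.
move=> sF; apply: contra => /(extends_ends sF).
by case/andP: sF => /matchingP[_ ->].
Qed.

Lemma matchingJ s t : matching s -> matching (s ^ t)%g.
Proof.
case/matchingP=> s1 s2; apply/matchingP; split=> x; rewrite -[x](permKV t).
  by rewrite permJ (inj_eq perm_inj).
by rewrite !permJ s2.
Qed.

(** The transposition fixes the ends of the prescribed edges, so that
    conjugating by it renames only half-edges about which [F] says nothing. *)
Lemma extendsJ F s a b : a \notin ends_of F -> b \notin ends_of F ->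
  extends F (s ^ tperm a b)%g = extends F s.
Proof.
move=> aF bF; have h s' : extends F s' -> extends F (s' ^ tperm a b)%g.
  case/andP=> ms /allP sF; rewrite /extends matchingJ //=; apply/allP=> -[u v] uvF /=.
  have tF w : w \in ends_of F -> tperm a b w = w.
    by move=> wF; rewrite tpermD //; apply: contraTneq wF => <-.
  have uF : u \in ends_of F by rewrite mem_cat (map_f fst uvF).
  have vF : v \in ends_of F by rewrite mem_cat (map_f snd uvF) orbT.
  by rewrite -{1}(tF u uF) permJ (eqP (sF _ uvF)) /= tF.
apply/idP/idP => /h //; suff -> : ((s ^ tperm a b) ^ tperm a b)%g = s by [].
by rewrite -conjgM tperm2 conjg1.
Qed.

(** Conjugation by the transposition of [s x] and [y] exchanges the names of
    these two points: [x] is now matched to [y], and [s x] to [s y]. *)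
Definition switch s x y : {perm T} := (s ^ tperm (s x) y)%g.

Lemma switch_x s x y : matching s -> x != y -> switch s x y x = y.
Proof.
case/matchingP=> s1 _ xy; rewrite /switch.
have tx : tperm (s x) y x = x by rewrite tpermD // eq_sym.
by rewrite -{2}tx permJ tpermL.
Qed.

Lemma switch_out s x y u : matching s ->
  u \notin [:: x; y; s x; s y] -> switch s x y u = s u.
Proof.
case/matchingP=> s1 s2; rewrite !inE !negb_or => /and4P[ux uy usx usy].
have tu : tperm (s x) y u = u by rewrite tpermD // eq_sym.
rewrite -{1}tu permJ tpermD ?(inj_eq perm_inj) 1?eq_sym //.
by apply: contra usy => /eqP <-; rewrite s2.
Qed.

Lemma extends_switch F s x y : extends F s -> uniq (ends_of ((x, y) :: F)) ->
  extends ((x, y) :: F) (switch s x y).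
Proof.
move=> sF; rewrite uniq_ends_cons => /and4P[xy xF yF _].
rewrite extends_cons switch_x ?(extends_matching sF) // eqxx andbT.
by rewrite extendsJ // (extends_out sF).
Qed.

Section Expectation.
Variable R : realFieldType.
Implicit Types (h : {perm T} -> R).

(** The mean of [h] over a uniform perfect matching conditioned to contain
    the edges of [F]. *)
Definition mean F h : R := (\sum_(s | extends F s) h s) / #|extends F|%:R.

(** For each value [z] of [s x], conjugation by the transposition of [z] and
    [y] is a bijection from the matchings with [s x = z] to those with
    [s x = y].  Thus switching a uniform matching gives a uniform matching
    through the new edge, which moreover is independent of the former mate
    [s x]. *)
Lemma sum_switch F x y (h : {perm T} -> T -> R) :
  uniq (ends_of ((x, y) :: F)) ->
  \sum_(s | extends F s) h (switch s x y) (s x) =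
  \sum_(z | z \notin x :: ends_of F) \sum_(s | extends ((x, y) :: F) s) h s z.
Proof.
rewrite uniq_ends_cons => /and4P[xy xF yF uF].
rewrite (partition_big (fun s : {perm T} => s x) [pred z | z \notin x :: ends_of F]) /=; last first.
  move=> s sF; rewrite inE negb_or (extends_out sF) // andbT.
  by have /matchingP[-> _] := extends_matching sF.
apply: eq_bigr => z; rewrite inE negb_or => /andP[zx zF].
rewrite (reindex_inj (h := fun s : {perm T} => (s ^ tperm z y)%g)) /=; last exact: conjg_inj.
have tx : tperm z y x = x by rewrite tpermD // eq_sym.
apply: eq_big => [s|s].
  rewrite extends_cons extendsJ //; congr (_ && _).
  rewrite -{1}tx permJ -{2}(tpermR z y).
  by rewrite (inj_eq perm_inj).
case/andP=> _ /eqP sx; congr (h _ _); rewrite // /switch sx.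
by rewrite -conjgM tperm2 conjg1.
Qed.

Lemma card_out F x : uniq (ends_of F) -> x \notin ends_of F ->
  (#|[pred z | z \notin x :: ends_of F]| = #|T| - (size F).*2.+1)%N.
Proof.
move=> uF xF; have := cardC (mem (x :: ends_of F)).
by rewrite (card_uniqP _) /= ?xF // size_ends => <-; rewrite addKn; apply: eq_card.
Qed.

Lemma card_extends F x y : uniq (ends_of ((x, y) :: F)) ->
  (#|extends F| = (#|T| - (size F).*2.+1) * #|extends ((x, y) :: F)|)%N.
Proof.
move=> u; apply/eqP; rewrite -(eqr_nat R) natrM; apply/eqP.
have := sum_switch (fun _ _ => 1) u; rewrite !sumr_const card_out.
- by move=> h; rewrite mulr_natl; exact: h.
all: by move: u; rewrite uniq_ends_cons => /and4P[].
Qed.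

Lemma eq_mean F h1 h2 : (forall s, extends F s -> h1 s = h2 s) -> mean F h1 = mean F h2.
Proof. by move=> h12; rewrite /mean (eq_bigr _ h12). Qed.

Lemma le_mean F h1 h2 : (forall s, extends F s -> h1 s <= h2 s) -> mean F h1 <= mean F h2.
Proof.
by move=> h12; rewrite /mean ler_wpM2r ?invr_ge0 ?ler0n //; apply: ler_sum => s; exact: h12.
Qed.

Lemma mean_ge0 F h : (forall s, extends F s -> 0 <= h s) -> 0 <= mean F h.
Proof. by move=> h0; rewrite /mean divr_ge0 ?ler0n ?sumr_ge0. Qed.

Lemma meanD F h1 h2 : mean F (fun s => h1 s + h2 s) = mean F h1 + mean F h2.
Proof. by rewrite /mean big_split mulrDl. Qed.

Lemma meanN F h : mean F (fun s => - h s) = - mean F h.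
Proof. by rewrite /mean sumrN mulNr. Qed.

Lemma meanZ F c h : mean F (fun s => c * h s) = c * mean F h.
Proof. by rewrite /mean -mulr_sumr mulrA. Qed.

Lemma mean0 F : mean F (fun=> 0) = 0.
Proof. by rewrite /mean big1 ?mul0r. Qed.

Lemma mean_sum F (I : finType) (P : pred I) (h : I -> {perm T} -> R) :
  mean F (fun s => \sum_(i | P i) h i s) = \sum_(i | P i) mean F (h i).
Proof. by rewrite /mean exchange_big mulr_suml. Qed.

Lemma ler_norm_mean F h : `|mean F h| <= mean F (fun s => `|h s|).
Proof.
rewrite /mean normrM normfV [`|_%:R|]ger0_norm ?ler0n // ler_wpM2r ?invr_ge0 ?ler0n //.
exact: ler_norm_sum.
Qed.

Lemma mean1 F : (0 < #|extends F|)%N -> mean F (fun=> 1) = 1.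
Proof. by move=> F0; rewrite /mean sumr_const divff // pnatr_eq0 -lt0n. Qed.

Lemma mean_1_le1 F : mean F (fun=> 1) <= 1.
Proof.
have [F0|F0] := posnP #|extends F|; last by rewrite mean1.
by rewrite /mean F0 invr0 mulr0.
Qed.

(** The number of possible mates of a half-edge outside [F]. *)
Definition free_mates F : R := (#|T| - (size F).*2.+1)%:R.

(** Under the switch the former mate [s x] of [x] is uniform and independent
    of the new matching; this controls the edge between [s x] and [s y], which
    the switch creates at a random place. *)
Lemma mean_switch_mate F x y (h : {perm T} -> T -> R) :
  uniq (ends_of ((x, y) :: F)) ->
  mean F (fun s => h (switch s x y) (s x)) =
  (free_mates F)^-1 *
    \sum_(z | z \notin x :: ends_of F) mean ((x, y) :: F) (fun s => h s z).
Proof.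
move=> u; rewrite /mean sum_switch // -mulr_suml (card_extends u) natrM invfM -/(free_mates F).
by rewrite mulrCA.
Qed.

Lemma mean_edge F x y h : uniq (ends_of ((x, y) :: F)) ->
  mean F (fun s => (s x == y)%:R * h s) = (free_mates F)^-1 * mean ((x, y) :: F) h.
Proof.
move=> u; rewrite /mean (card_extends u) natrM invfM -/(free_mates F) mulrCA.
congr (_ * (_ / _)); rewrite (bigID (fun s : {perm T} => s x == y)) /=.
rewrite [X in _ + X]big1 ?addr0 => [|s /andP[_ /negbTE->]]; last by rewrite mul0r.
apply: eq_big => [s|s]; first by rewrite extends_cons.
by case/andP => _ ->; rewrite mul1r.
Qed.

Lemma card_extends_gt0 F x y : uniq (ends_of ((x, y) :: F)) ->
  (0 < #|extends F|)%N -> (0 < free_mates F) && (0 < #|extends ((x, y) :: F)|)%N.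
Proof. by move=> u; rewrite (card_extends u) muln_gt0 /free_mates ltr0n. Qed.

Lemma mean_switch F x y h : uniq (ends_of ((x, y) :: F)) ->
  mean ((x, y) :: F) h = mean F (fun s => h (switch s x y)).
Proof.
move=> u; have [F0|F0] := posnP #|extends F|.
  rewrite /mean F0 invr0 mulr0 big_pred0 ?mul0r // => s.
  by rewrite extends_cons; have -> : extends F s = false by exact: (card0_eq F0 s).
have /andP[c0 _] := card_extends_gt0 u F0.
rewrite (mean_switch_mate (fun s _ => h s) u) sumr_const card_out.
- by rewrite -mulr_natl mulKf // gt_eqF.
all: by move: u; rewrite uniq_ends_cons => /and4P[].
Qed.

End Expectation.
End Matchings.

Section Existence.
Variable T : finType.
Hypothesis T_even : ~~ odd #|T|.

Let swap (i : nat) : nat := if odd i then i.-1 else i.+1.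

Let swap_lt (i : 'I_#|T|) : (swap i < #|T|)%N.
Proof. by move: (ltn_ord i) T_even; rewrite /swap; case: ifP; lia. Qed.

Let mate (x : T) : T := enum_val (Ordinal (swap_lt (enum_rank x))).

Let mateK : involutive mate.
Proof.
move=> x; rewrite /mate; set y := enum_val _; apply: enum_rank_inj.
rewrite enum_valK; apply: val_inj; rewrite /= /y enum_valK /= /swap.
by move: (enum_rank x : nat) => i; case h: (odd i); case: ifP; lia.
Qed.

(** Enumerating the points, the even ranks are matched to their successors. *)
Lemma matching_exists : (0 < #|extends ([::] : seq (T * T))|)%N.
Proof.
apply/card_gt0P; exists (perm (inv_inj mateK)); rewrite unfold_in -/(extends _ _) extends_nil.
apply/matchingP; split=> x; rewrite !permE; last exact: mateK.
apply/eqP => /(congr1 enum_rank); rewrite enum_valK => /(congr1 val) /=.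
rewrite /swap; move: (enum_rank x : nat) => i; case h: (odd i); first by case: i h => // i _; lia.
lia.
Qed.

End Existence.

(** * A weight that detects loops and parallel edges *)

Section Weight.
Variables (T : finType) (V : eqType) (own : T -> V).
Implicit Types (s : {perm T}) (x y z w u v : T).

(** The contribution of an ordered pair of half-edges to the weight: a loop
    is seen from each of its two ends and contributes 2 each time, two parallel
    edges that are not loops are seen from four ordered pairs of ends.  Either
    structure thus adds 4 to [weight]. *)
Definition defect s u v : nat :=
  if u == v then (own (s u) == own u).*2
  else [&& own u == own v, own (s u) == own (s v) & own (s u) != own u].

(** The part of the weight that comes from the half-edges in [P]: two
    matchings that agree on [P] have the same one. *)
Definition weight_in s (P : pred T) : nat :=
  (\sum_u \sum_v (P u && P v) * defect s u v)%N.

Definition weight s : nat := weight_in s predT.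

(** A quarter of the weight due to the edge at [x]: see [weight_peel]. *)
Definition local_weight s x : nat :=
  ((own (s x) == own x) + \sum_(v | v != x) defect s x v)%N.

Lemma defectC s u v : defect s u v = defect s v u.
Proof.
rewrite /defect eq_sym; case: eqP => [-> // | _].
rewrite eq_sym [own (s u) == _]eq_sym.
by case: (own v =P own u) => //= ->; case: (own (s v) =P own (s u)) => //= ->.
Qed.

Lemma defect_mate s u v : matching s -> defect s (s u) (s v) = defect s u v.
Proof.
case/matchingP=> _ sI; rewrite /defect (inj_eq perm_inj) !sI [own u == own (s u)]eq_sym.
by do ! case: (_ == _).
Qed.

Lemma defect_mate0 s x : matching s -> defect s x (s x) = 0%N.
Proof.
case/matchingP=> s1 sI; rewrite /defect eq_sym (negbTE (s1 x)) sI [own x == _]eq_sym.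
by case: (_ == _).
Qed.

Lemma sum_defect s x :
  (\sum_v defect s x v = (own (s x) == own x) + local_weight s x)%N.
Proof. by rewrite (bigD1 x) //= {1}/defect eqxx -addnn -addnA. Qed.

Lemma local_weight_mate s x : matching s -> local_weight s (s x) = local_weight s x.
Proof.
move=> ms; have /matchingP[_ sI] := ms.
have h1 := sum_defect s x; have h2 := sum_defect s (s x).
rewrite sI [own x == _]eq_sym (reindex_inj (@perm_inj _ s)) /= in h2.
rewrite (eq_bigr _ (fun v _ => defect_mate x v ms)) h1 in h2.
by move/eqP: h2; rewrite eqn_add2l => /eqP.
Qed.

(** The pairs meeting the edge [{x, s x}] have their first or their second
    component in it, and the matching exchanges the pairs that contain [x] with
    those that contain [s x]; this gives four equal sums. *)
Lemma weight_peel s x : matching s ->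
  weight s = (weight_in s [pred u | (u != x) && (u != s x)] + 4 * local_weight s x)%N.
Proof.
move=> ms; have /matchingP[s1 sI] := ms.
pose r u := (\sum_v defect s u v)%N.
pose P := [pred u | (u != x) && (u != s x)].
pose q u := (\sum_v (P u && P v) * defect s u v)%N.
have rE u : u != x -> u != s x -> (r u = q u + (defect s x u + defect s (s x) u))%N.
  move=> ux usx; rewrite /r (bigD1 x) //= (bigD1 (s x)) ?s1 //=.
  rewrite /q [in RHS](bigD1 x) //= [X in _ = (_ + X + _)%N](bigD1 (s x)) ?s1 //=.
  rewrite ux usx !eqxx /= !mul0n !add0n [defect s u x]defectC [defect s u (s x)]defectC.
  rewrite addnA addnC; congr (_ + _)%N; apply: eq_bigr => v /andP[vx vsx].
  by rewrite vx vsx mul1n.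
have r0 u : ~~ P u -> q u = 0%N.
  by move/negbTE=> Pu; apply: big1 => v _; rewrite Pu mul0n.
have -> : weight s = (\sum_u r u)%N.
  by apply: eq_bigr => u _; apply: eq_bigr => v _; rewrite mul1n.
have -> : weight_in s P = (\sum_u q u)%N by [].
rewrite (bigD1 x) //= (bigD1 (s x)) ?s1 //=.
rewrite [in RHS](bigD1 x) //= [X in _ = (_ + X + _)%N](bigD1 (s x)) ?s1 //=.
rewrite r0 /= ?eqxx // r0 /= ?eqxx ?andbF // !add0n.
rewrite (eq_bigr _ (fun u h => rE u (proj1 (andP h)) (proj2 (andP h)))).
rewrite big_split /= big_split /=.
set A := (\sum_(_ | _) _)%N.
have B1 : (\sum_(i | (i != x) && (i != s x)) defect s x i + (own (s x) == own x) = local_weight s x)%N.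
  by rewrite /local_weight [in RHS](bigD1 (s x)) ?s1 //= defect_mate0 // addnC.
have B2 : (\sum_(i | (i != x) && (i != s x)) defect s (s x) i + (own (s x) == own x) = local_weight s x)%N.
  rewrite -(local_weight_mate x ms) /local_weight sI [own x == _]eq_sym addnC.
  rewrite [in RHS](bigD1 x) /=; last by rewrite eq_sym.
  rewrite [defect s (s x) x]defectC defect_mate0 // add0n.
  by congr (_ + _)%N; apply: eq_bigl => i; rewrite andbC.
rewrite /r !sum_defect local_weight_mate // sI [own x == own (s x)]eq_sym.
move: B1 B2; set a := BIG_F; set B := (\sum_(_ | _) _)%N; set C := (\sum_(_ | _) _)%N.
lia.
Qed.

Lemma weight_in_le s (P Q : pred T) : (forall u, P u -> Q u) ->
  (weight_in s P <= weight_in s Q)%N.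
Proof.
move=> PQ; apply: leq_sum => u _; apply: leq_sum => v _; rewrite leq_mul2r.
by apply/orP; right; case Pu: (P u); case Pv: (P v); rewrite ?(PQ _ Pu) ?(PQ _ Pv).
Qed.

(** Inside [Q] the edge at [x] loses at most what it loses in the whole set,
    since a pair within [Q] that meets the edge is one of all the pairs that
    meet it. *)
Lemma weight_in_peel s x (Q : pred T) : matching s ->
  (weight_in s Q <=
   weight_in s [pred u | Q u && [pred u | (u != x) && (u != s x)] u] + 4 * local_weight s x)%N.
Proof.
move=> ms.
(* Adding the weight off the edge to both sides leaves an inequality between
   indicators, to be checked pair by pair. *)
rewrite -(leq_add2r (weight_in s [pred u | (u != x) && (u != s x)])).
rewrite -addnA [(4 * _ + _)%N]addnC -weight_peel // /weight /weight_in -!big_split.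
apply: leq_sum => u _; rewrite -!big_split; apply: leq_sum => v _ /=.
by rewrite -!mulnDl leq_mul2r; apply/orP; right; case: (Q u); case: (Q v); do ! case: (_ == _).
Qed.

Lemma eq_weight_in s s' (P : pred T) : (forall u, P u -> s u = s' u) ->
  weight_in s P = weight_in s' P.
Proof.
move=> ss'; apply: eq_bigr => u _; apply: eq_bigr => v _.
case Pu: (P u); case Pv: (P v) => //=.
by rewrite !mul1n /defect !ss'.
Qed.

Lemma switch_id s x : switch s x (s x) = s.
Proof. by rewrite /switch tperm1 conjg1. Qed.

Lemma switch_mate s x y : matching s -> x != y -> s x != y ->
  switch s x y (s x) = s y.
Proof.
case/matchingP=> s1 sI xy sxy; rewrite /switch -{2}(tpermR (s x) y) permJ tpermD //.
  by rewrite (inj_eq perm_inj).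
by rewrite eq_sym s1.
Qed.

(** The matchings [s] and [s'] agree off the four points [x], [y], [s x] and
    [s y].  So the weight changes by what the edges at [x] and at [s x] weigh
    in [s'], less what the edges at [x] and at [y] weigh in [s].  The term of
    the new edge at [x] is kept exact, because it holds the structure that the
    switch is meant to create; the others are errors.  If [s x = y] nothing
    changes and the edge at [s x] is the one at [x], hence the factor. *)
Lemma weight_switch s x y (s' := switch s x y) : matching s -> x != y ->
  (weight s' <= weight s + 4 * local_weight s' x
                + 4 * ((s x != y) * local_weight s' (s x)))%N /\
  (weight s + 4 * local_weight s' x <=
     weight s' + 4 * local_weight s x + 4 * local_weight s y)%N.
Proof.
move=> ms xy; have /matchingP[s1 sI] := ms.
have [e|sxy] := eqVneq (s x) y.
  have -> : s' = s by rewrite /s' -e switch_id.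
  by split; lia.
have ms' : matching s' by exact: matchingJ.
have s'x : s' x = y by exact: switch_x.
have s'z : s' (s x) = s y by exact: switch_mate.
pose P : pred T := [pred u | u \notin [:: x; y; s x; s y]].
have eP : weight_in s P = weight_in s' P.
  by apply: eq_weight_in => u Pu; rewrite /s' switch_out.
have h1 : (weight s <= weight_in s P + 4 * local_weight s x + 4 * local_weight s y)%N.
  rewrite (weight_peel x ms) addnAC leq_add2r.
  apply: leq_trans (weight_in_peel y _ ms) _; rewrite leq_add2r.
  apply: weight_in_le => u; rewrite /P /= ?inE; do ! case: (u == _) => //=.
have h2 := weight_peel x ms'; rewrite s'x in h2.
have h3 : (weight_in s' [pred u | (u != x) && (u != y)] <= weight_in s' P + 4 * local_weight s' (s x))%N.
  apply: leq_trans (weight_in_peel (s x) _ ms') _; rewrite leq_add2r s'z.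
  apply: weight_in_le => u; rewrite /P /= ?inE; do ! case: (u == _) => //=.
have h4 : (weight_in s' P <= weight_in s' [pred u | (u != x) && (u != y)])%N.
  apply: weight_in_le => u; rewrite /P /= ?inE; do ! case: (u == _) => //=.
have h5 : (weight_in s P <= weight s)%N by exact: weight_in_le.
rewrite /= mul1n; split; lia.
Qed.

End Weight.

(** * First-moment estimates *)

Section Estimates.
Variables (R : realFieldType) (T : finType) (V : eqType) (own : T -> V).
Variable Delta : nat.
Hypothesis owned : forall a, (#|[pred y | own y == a]| <= Delta)%N.
Hypothesis T_large : (14 <= #|T|)%N.
Implicit Types (s : {perm T}) (F : seq (T * T)) (x y z w u v : T).

Let M : R := #|T|%:R.

Definition siblings x y := (x != y) && (own x == own y).

Definition num_siblings : R := \sum_x \sum_y (siblings x y)%:R.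

(** Of order [(1 + Lambda) * Delta / #|T|], as [num_siblings] is
    [2 * Lambda * #|T|]. *)
Definition local_bound : R := 10 * Delta%:R / M + 4 * Delta%:R * num_siblings / M ^+ 2.

Let M_gt0 : 0 < M. Proof. by rewrite ltr0n; apply: leq_trans T_large. Qed.

Lemma num_siblings_ge0 : 0 <= num_siblings.
Proof. by apply: sumr_ge0 => x _; apply: sumr_ge0. Qed.

Lemma local_bound_ge0 : 0 <= local_bound.
Proof.
have := num_siblings_ge0; have : (0 : R) <= Delta%:R by [].
by move=> h1 h2; rewrite addr_ge0 // divr_ge0 ?mulr_ge0 ?exprn_ge0 // ltW.
Qed.

Lemma free_mates_gt0 F : (size F <= 3)%N -> 0 < free_mates R F.
Proof. by move=> F3; rewrite ltr0n; move: T_large; lia. Qed.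

Lemma free_mates_inv F : (size F <= 3)%N -> (free_mates R F)^-1 <= 2 / M.
Proof.
move=> F3; rewrite -[2 / M]invrK lef_pV2 ?posrE ?free_mates_gt0 ?invr_gt0 ?divr_gt0 //.
rewrite invf_div ler_pdivrMr // /free_mates -natrM ler_nat.
by move: T_large; lia.
Qed.

(** The half-edges used by [F], and [x] itself, are not available as mates of
    [x]. *)
Lemma extends_edgeF F x y : uniq (ends_of F) -> x \notin ends_of F ->
  ~~ uniq (ends_of ((x, y) :: F)) -> forall s, extends F s -> (s x == y) = false.
Proof.
rewrite uniq_ends_cons => uF xF; rewrite xF uF andbT /= negb_and !negbK => h s sF.
apply/negP => /eqP sx; case/orP: h => [/eqP xy|yF].
  by have /matchingP[/(_ x) /eqP[]] := extends_matching sF; rewrite sx -xy.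
by move: yF; rewrite -sx (negbTE (extends_out sF xF)).
Qed.

Lemma prob_edge_inv_le F x y : uniq (ends_of F) -> x \notin ends_of F ->
  mean F (fun s => (s x == y)%:R) <= (free_mates R F)^-1.
Proof.
move=> uF xF; have L0 : 0 <= (free_mates R F)^-1 by rewrite invr_ge0 ler0n.
have [u|nu] := boolP (uniq (ends_of ((x, y) :: F))); last first.
  rewrite (@eq_mean _ _ _ _ (fun=> 0)) ?mean0 // => s sF.
  by rewrite (extends_edgeF uF xF nu sF) ?mul0r.
rewrite (@eq_mean _ _ _ _ (fun s => (s x == y)%:R * 1)) => [|s _]; last by rewrite mulr1.
by rewrite mean_edge // ler_piMr ?mean_1_le1.
Qed.

Lemma prob_edge_le F x y : uniq (ends_of F) -> x \notin ends_of F ->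
  (size F <= 3)%N -> mean F (fun s => (s x == y)%:R) <= 2 / M.
Proof.
by move=> uF xF F3; apply: le_trans (prob_edge_inv_le y uF xF) (free_mates_inv F3).
Qed.

Lemma prob_edge2_le F x v z w : uniq (ends_of F) -> x \notin ends_of F ->
  v \notin ends_of F -> x != v -> z != v -> (size F <= 2)%N ->
  mean F (fun s => (s x == z)%:R * (s v == w)%:R) <= 4 / M ^+ 2.
Proof.
move=> uF xF vF xv zv F2.
have M4 : 4 / M ^+ 2 = 2 / M * (2 / M) by rewrite expr2 invfM; ring.
have M2 : 0 <= 2 / M by rewrite divr_ge0 // ltW.
have [u|nu] := boolP (uniq (ends_of ((x, z) :: F))); last first.
  rewrite M4 (@eq_mean _ _ _ _ (fun=> 0)) ?mean0 ?(mulr_ge0 M2 M2) // => s sF.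
  by rewrite (extends_edgeF uF xF nu sF) ?mul0r.
have F3 : (size F <= 3)%N by apply: leq_trans F2 _.
rewrite mean_edge // M4; apply: ler_pM.
- by rewrite invr_ge0 ltW // free_mates_gt0.
- exact: mean_ge0.
- exact: free_mates_inv.
apply: prob_edge_le => //.
suff : v \notin x :: z :: ends_of F.
  by rewrite !inE !negb_or /ends_of !mem_cat /= !inE =>
    /and3P[/negbTE-> /negbTE-> /norP[/negbTE-> /negbTE->]].
by rewrite !inE !negb_or vF [v == x]eq_sym xv [v == z]eq_sym zv.
Qed.

Lemma prob_owner_le F x a : uniq (ends_of F) -> x \notin ends_of F ->
  (size F <= 3)%N -> mean F (fun s => (own (s x) == a)%:R) <= 2 * Delta%:R / M.
Proof.
move=> uF xF F3.
rewrite (@eq_mean _ _ _ _ (fun s => \sum_(y | own y == a) (s x == y)%:R)); last first.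
  move=> s _; case: (own (s x) =P a) => [e|ne].
    rewrite (bigD1 (s x)) ?e ?eqxx //= big1 ?addr0 // => y /andP[_].
    by rewrite eq_sym => /negbTE ->.
  by rewrite big1 // => y /eqP e; case: eqP => // e'; case: ne; rewrite e'.
rewrite mean_sum; apply: le_trans (_ : \sum_(y | own y == a) 2 / M <= _).
  by apply: ler_sum => y _; exact: prob_edge_le.
rewrite sumr_const -[leLHS]mulr_natl mulrCA mulrA ler_wpM2r ?invr_ge0 ?(ltW M_gt0) //.
by rewrite ler_wpM2l // ler_nat; exact: owned.
Qed.

Lemma ends_mate F v : v \in ends_of F -> exists c, forall s, extends F s -> s v = c.
Proof.
rewrite mem_cat => /orP[] /mapP[[a b] eF ->] /=.
  by exists b => s /andP[_ /allP/(_ _ eF)/eqP].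
exists a => s /andP[/matchingP[_ sI] /allP/(_ _ eF)/eqP /= <-].
exact: sI.
Qed.

Lemma card_siblings x : (#|[pred v | siblings x v]| <= Delta)%N.
Proof.
apply: leq_trans (owned (own x)); apply: subset_leq_card; apply/fintype.subsetP => v.
by rewrite !inE /siblings => /andP[_ /eqP->].
Qed.

Lemma sum_siblings x (c : R) : 0 <= c -> \sum_v (siblings x v)%:R * c <= Delta%:R * c.
Proof.
move=> c0; rewrite -mulr_suml ler_wpM2r // -natr_sum ler_nat.
by rewrite -big_mkcond sum1_card card_siblings.
Qed.

Lemma defect_le s x v : v != x ->
  (defect own s x v)%:R <= (siblings x v && (own (s v) == own (s x)))%:R :> R.
Proof.
move=> vx; rewrite /defect /siblings [x == v]eq_sym vx (negbTE vx) ler_nat [own (s v) == _]eq_sym.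
by do ! case: (_ == _).
Qed.

(** If [v] is an end of [F] then its mate is determined, and the mate of [x]
    must fall at a given vertex.  Otherwise the mates of [x] and [v] are two
    half-edges at one vertex: there are [num_siblings] candidates, each of
    probability at most [4 / #|T| ^ 2]. *)
Lemma mean_defect_le F x v : uniq (ends_of F) -> x \notin ends_of F ->
  (size F <= 2)%N -> v != x ->
  mean F (fun s => (defect own s x v)%:R) <=
    (siblings x v)%:R * (4 * num_siblings / M ^+ 2) + (v \in ends_of F)%:R * (2 * Delta%:R / M).
Proof.
move=> uF xF F2 vx.
have F3 : (size F <= 3)%N by apply: leq_trans F2 _.
have A0 : 0 <= 4 * num_siblings / M ^+ 2.
  by rewrite divr_ge0 ?mulr_ge0 ?num_siblings_ge0 // exprn_ge0 // ltW.
have [vF|vF] := boolP (v \in ends_of F).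
  rewrite mul1r; apply: ler_wpDl; first by rewrite mulr_ge0.
  have [c vc] := ends_mate vF; apply: le_trans (prob_owner_le (own c) uF xF F3).
  apply: le_mean => s sF; apply: le_trans (defect_le s vx) _.
  by rewrite (vc s sF) ler_nat eq_sym; case: (siblings _ _); case: (_ == _).
rewrite mul0r addr0; have [xv|nxv] := boolP (siblings x v); last first.
  apply: (@le_trans _ _ (mean F (fun=> 0))); last by rewrite mean0 mul0r.
  by apply: le_mean => s _; apply: le_trans (defect_le s vx) _; rewrite (negbTE nxv).
(* If [s x = v] the edge at [x] is a loop, because [v] is a sibling of [x], and
   [defect] vanishes; hence the condition [z != v]. *)
rewrite mul1r; apply: le_trans (_ : mean F (fun s => \sum_z \sum_w (siblings z w && (z != v))%:R *
   ((s x == z)%:R * (s v == w)%:R)) <= _).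
  apply: le_mean => s sF; rewrite (bigD1 (s x)) //= (bigD1 (s v)) //= !eqxx !mulr1.
  rewrite -addrA; apply: ler_wpDr; first by rewrite addr_ge0 ?sumr_ge0 // => *; rewrite ?sumr_ge0.
  rewrite ler_nat /defect /siblings (inj_eq perm_inj) [x == v]eq_sym vx (negbTE vx).
  case/andP: xv => _ /eqP->; rewrite eqxx /=.
  case: (own (s x) =P own (s v)) => //= _; case: (s x =P v) => [->|_]; first by rewrite eqxx.
  exact: leq_b1.
rewrite mean_sum; under eq_bigr do rewrite mean_sum.
rewrite mulrAC mulrC /num_siblings mulr_suml; apply: ler_sum => z _.
rewrite mulr_suml; apply: ler_sum => w _; rewrite meanZ.
case: (boolP (siblings z w)) => //= szw; last by rewrite !mul0r.
case: (boolP (z != v)) => zv; last by rewrite mul0r mul1r divr_ge0 // exprn_ge0 // ltW.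
by rewrite !mul1r; apply: prob_edge2_le => //; rewrite eq_sym.
Qed.

(** The edge at [x] has a random second end.  It is a loop with probability
    [O (Delta / #|T|)], and [mean_defect_le] is summed over the at most [Delta]
    siblings of [x] and the at most 4 ends of [F]. *)
Lemma mean_local_weight_le F x : uniq (ends_of F) -> x \notin ends_of F ->
  (size F <= 2)%N -> mean F (fun s => (local_weight own s x)%:R) <= local_bound.
Proof.
move=> uF xF F2; have F3 : (size F <= 3)%N by apply: leq_trans F2 _.
rewrite (@eq_mean _ _ _ _ (fun s => (own (s x) == own x)%:R +
    \sum_(v | v != x) (defect own s x v)%:R)); last first.
  by move=> s _; rewrite /local_weight natrD natr_sum.
rewrite meanD mean_sum.
have h1 := prob_owner_le (own x) uF xF F3.
have A0 : 0 <= 4 * num_siblings / M ^+ 2.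
  by rewrite divr_ge0 ?mulr_ge0 ?num_siblings_ge0 // exprn_ge0 // ltW.
have B0 : 0 <= 2 * Delta%:R / M by rewrite divr_ge0 ?mulr_ge0 // ltW.
have h2 : \sum_(v | v != x) mean F (fun s => (defect own s x v)%:R) <=
    Delta%:R * (4 * num_siblings / M ^+ 2) + 4 * (2 * Delta%:R / M).
  apply: le_trans (_ : \sum_v ((siblings x v)%:R * (4 * num_siblings / M ^+ 2) +
      (v \in ends_of F)%:R * (2 * Delta%:R / M)) <= _).
    rewrite [leRHS](bigD1 x) //=; apply: ler_wpDl; first by apply: addr_ge0; apply: mulr_ge0.
    by apply: ler_sum => v vx; exact: mean_defect_le.
  rewrite big_split /= lerD ?sum_siblings // -mulr_suml ler_wpM2r // -natr_sum ler_nat.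
  rewrite -big_mkcond sum1_card; apply: leq_trans (card_size _) _.
  by rewrite size_ends; lia.
apply: le_trans (lerD h1 h2) _; rewrite /local_bound.
by apply: eq_ler; ring.
Qed.

(** When both ends [x] and [y] of an edge are prescribed, a parallel edge needs
    one of the at most [Delta] siblings of [x] to be matched to one of the at
    most [Delta] half-edges at the vertex of [y].  This is the step that
    requires [Delta ^ 2] to be small compared with the number of half-edges. *)
Lemma mean_defect_out_le F x y : uniq (ends_of F) -> (size F <= 3)%N ->
  (forall s, extends F s -> s x = y) -> x \in ends_of F ->
  mean F (fun s => \sum_(v | v \notin ends_of F) (defect own s x v)%:R) <=
    2 * Delta%:R ^+ 2 / M.
Proof.
move=> uF F3 sx xF; rewrite mean_sum.
have B0 : 0 <= 2 * Delta%:R / M by rewrite divr_ge0 ?mulr_ge0 // ltW.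
apply: le_trans (_ : \sum_v (siblings x v)%:R * (2 * Delta%:R / M) <= _); last first.
  apply: le_trans (sum_siblings _ B0) _; apply: eq_ler; ring.
rewrite [leRHS](bigID (fun v => v \notin ends_of F)) /=.
apply: ler_wpDr; first by apply: sumr_ge0 => v _; rewrite mulr_ge0.
apply: ler_sum => v vF.
have vx : v != x by apply: contra vF => /eqP->.
apply: le_trans (_ : mean F (fun s => (siblings x v)%:R * (own (s v) == own y)%:R) <= _).
  apply: le_mean => s sF; apply: le_trans (defect_le s vx) _.
  by rewrite (sx s sF) -natrM mulnb.
by rewrite meanZ ler_wpM2l // prob_owner_le.
Qed.

End Estimates.

(** * The effect of a switch on the weight, in mean *)

Section Comparison.
Variables (R : realFieldType) (T : finType) (V : eqType) (own : T -> V).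
Variable Delta : nat.
Hypothesis owned : forall a, (#|[pred y | own y == a]| <= Delta)%N.
Hypothesis T_large : (14 <= #|T|)%N.
Implicit Types (s : {perm T}) (F : seq (T * T)) (x y z w u v : T).

Let W s := weight own s.
Let bt : R := local_bound R own Delta.

(** Creating the edge [{x, y}] by a switch shifts the weight by [4 * c], up to
    a small mean error, provided that the new edge has local weight [c] up to
    a small mean error [gamma].  It is meant for functions [phi] and [psi]
    that are powers of a number between 0 and 1, which are 1-Lipschitz in the
    exponent. *)
Lemma mean_switch_weight F x y (c : nat) (gamma : R) (phi psi : nat -> R) :
  uniq (ends_of ((x, y) :: F)) -> (size F <= 1)%N ->
  (forall s, extends ((x, y) :: F) s -> (c <= local_weight own s x)%N) ->
  mean ((x, y) :: F) (fun s => (local_weight own s x)%:R - c%:R) <= gamma ->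
  (forall s, extends F s -> (c <= W (switch s x y))%N ->
     `|phi (W (switch s x y)) - psi (W s)| <=
     `|(W (switch s x y))%:R - ((W s)%:R + 4 * c%:R)|) ->
  `|mean ((x, y) :: F) (fun s => phi (W s)) - mean F (fun s => psi (W s))|
    <= 12 * bt + 4 * gamma.
Proof.
move=> u F1 cle cg phiL.
have := u; rewrite uniq_ends_cons => /and4P[xy xF yF uF].
have F2 : (size F <= 2)%N by apply: leq_trans F1 _.
have F3 : (size F <= 3)%N by apply: leq_trans F2 _.
rewrite mean_switch // -meanN -meanD; apply: le_trans (ler_norm_mean _ _) _.
pose k s v : R := (local_weight own s v)%:R.
apply: le_trans (_ : mean F (fun s => 4 * k s x + 4 * k s y +
   4 * ((s x != y)%:R * k (switch s x y) (s x)) + 4 * (k (switch s x y) x - c%:R)) <= _).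
  apply: le_mean => s sF.
  have sF' := extends_switch sF u.
  have cs : (c <= local_weight own (switch s x y) x)%N by exact: cle.
  have [h1 h2] := weight_switch own (extends_matching sF) xy.
  apply: le_trans (phiL s sF _) _.
    by rewrite /W (weight_peel own x (extends_matching sF')); move: cs; lia.
  have h1' : (W (switch s x y))%:R <= (W s)%:R + 4 * k (switch s x y) x
      + 4 * ((s x != y)%:R * k (switch s x y) (s x)).
    by rewrite /k -!natrM -!natrD ler_nat.
  have h2' : (W s)%:R + 4 * k (switch s x y) x <=
      (W (switch s x y))%:R + 4 * k s x + 4 * k s y.
    by rewrite /k -!natrM -!natrD ler_nat.
  have cs' : c%:R <= k (switch s x y) x by rewrite ler_nat.
  have k0 s' v : 0 <= k s' v by rewrite ler0n.
  have k1 := k0 s x; have k2 := k0 s y.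
  have k3 : 0 <= (s x != y)%:R * k (switch s x y) (s x) by rewrite mulr_ge0.
  by rewrite ler_norml; apply/andP; split; lra.
rewrite !meanD !meanZ.
have b1 : mean F (fun s => k s x) <= bt by exact: mean_local_weight_le.
have b2 : mean F (fun s => k s y) <= bt by exact: mean_local_weight_le.
have b3 : mean F (fun s => (s x != y)%:R * k (switch s x y) (s x)) <= bt.
  rewrite (mean_switch_mate (fun s z => (z != y)%:R * k s z) u).
  rewrite ler_pdivrMl ?free_mates_gt0 // /free_mates -(card_out uF xF).
  rewrite mulr_natl -sumr_const; apply: ler_sum => z; rewrite !inE negb_or => /andP[zx zF].
  rewrite meanZ; have [->|zy] := eqVneq z y; first by rewrite mul0r local_bound_ge0.
  rewrite mul1r; apply: mean_local_weight_le => //=.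
  by rewrite /ends_of mem_cat /= !inE !negb_or zx zy /=; rewrite mem_cat negb_or in zF.
have b4 : mean F (fun s => k (switch s x y) x - c%:R) <= gamma.
  by rewrite -(mean_switch (fun s => k s x - c%:R) u).
lra.
Qed.

End Comparison.

Lemma ler_dist_exp (R : realFieldType) (t : R) (i j : nat) : 0 <= t <= 1 ->
  `|t ^+ i - t ^+ j| <= `|i%:R - j%:R|.
Proof.
case/andP=> t0 t1; wlog ij : i j / (i <= j)%N.
  by move=> h; case: (leqP i j) => [|/ltnW] /h //; rewrite distrC [leRHS]distrC.
have tX n : 0 <= t ^+ n <= 1 by rewrite exprn_ge0 // exprn_ile1.
rewrite -(subnKC ij); move: (j - i)%N => m; elim: m => [|m IH].
  by rewrite addn0 !subrr normr0.
rewrite [leRHS]distrC natrD addrAC subrr add0r [leRHS]ger0_norm //.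
move: IH; rewrite [leRHS]distrC natrD addrAC subrr add0r [leRHS]ger0_norm // => IH.
rewrite addnS -natr1; have -> : t ^+ i - t ^+ (i + m).+1 =
  (t ^+ i - t ^+ (i + m)) + t ^+ (i + m) * (1 - t) by rewrite exprS; ring.
apply: le_trans (ler_normD _ _) _; apply: lerD => //.
have /andP[a b] := tX (i + m)%N.
by rewrite ger0_norm ?mulr_ge0 ?subr_ge0 // mulr_ile1 ?subr_ge0 // gerBl.
Qed.

Section Derivative.
Variables (R : realFieldType) (T : finType) (V : eqType) (own : T -> V).
Variable Delta : nat.
Hypothesis owned : forall a, (#|[pred y | own y == a]| <= Delta)%N.
Hypothesis T_large : (14 <= #|T|)%N.
Implicit Types (s : {perm T}) (F : seq (T * T)) (x y z w u v : T).

Let M : R := #|T|%:R.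
Let W s := weight own s.
Let bt : R := local_bound R own Delta.
Let sb := siblings own.

Variable t : R.
Hypothesis t01 : 0 <= t <= 1.

Lemma local_weight_le F s y : y \in ends_of F ->
  (local_weight own s y)%:R <= (own (s y) == own y)%:R
    + \sum_(v | (v \in ends_of F) && (v != y)) (defect own s y v)%:R
    + \sum_(v | v \notin ends_of F) (defect own s y v)%:R :> R.
Proof.
move=> yF; rewrite /local_weight natrD natr_sum -addrA lerD2l.
rewrite (bigID (fun v => v \in ends_of F)) /= lerD //.
  by apply: eq_ler; apply: eq_bigl => v; rewrite andbC.
apply: eq_ler; apply: eq_bigl => v.
by case: (boolP (v \in _)) => //=; rewrite ?andbF // andbT; case: eqP => // ->; rewrite yF.
Qed.

(** A loop has local weight exactly 1, because [defect] ignores the edges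
    parallel to a loop; so there is no error [gamma]. *)
Lemma switch_loop x y : sb x y ->
  `|mean [:: (x, y)] (fun s => t ^+ (W s).-1) - mean [::] (fun s => t ^+ (W s + 3))|
    <= 12 * bt.
Proof.
case/andP=> xy /eqP oxy.
have u : uniq (ends_of [:: (x, y)]) by rewrite uniq_ends_cons xy.
have k1 s : extends [:: (x, y)] s -> local_weight own s x = 1%N.
  rewrite extends_cons => /andP[_ /eqP sx].
  rewrite /local_weight sx oxy eqxx big1 // => v vx.
  by rewrite /defect eq_sym (negbTE vx) sx oxy eqxx !andbF.
have -> : 12 * bt = 12 * bt + 4 * 0 by rewrite mulr0 addr0.
apply: (mean_switch_weight owned T_large (c := 1) (phi := fun m => t ^+ m.-1)
   (psi := fun m => t ^+ (m + 3)) u) => //.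
- by move=> s /k1 ->.
- rewrite (@eq_mean _ _ _ _ (fun=> 0)) ?mean0 // => s /k1 ->.
  by rewrite subrr.
- move=> s _ W1; apply: le_trans (ler_dist_exp _ _ t01) _; rewrite -/(W _).
  by rewrite -subn1 natrB // natrD mulr1; apply: eq_ler; congr `|_|; ring.
Qed.

(** A double edge is created by two switches.  The first one creates an edge
    that is not a loop, and should leave the weight unchanged. *)
Lemma switch_first x z : own z != own x ->
  `|mean [:: (x, z)] (fun s => t ^+ (W s + 3)) - mean [::] (fun s => t ^+ (W s + 3))|
    <= 12 * bt + 4 * (2 * Delta%:R ^+ 2 / M).
Proof.
move=> oxz; have xz : x != z by apply: contraNneq oxz => ->.
have u : uniq (ends_of [:: (x, z)]) by rewrite uniq_ends_cons xz.
apply: (mean_switch_weight owned T_large (c := 0) (phi := fun m => t ^+ (m + 3))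
   (psi := fun m => t ^+ (m + 3)) u) => //.
- have xF : x \in ends_of [:: (x, z)] by rewrite mem_head.
  apply: le_trans (mean_defect_out_le R owned T_large u _ (y := z) _ xF) => //; last first.
    by move=> s; rewrite extends_cons => /andP[_ /eqP].
  apply: le_mean => s; rewrite extends_cons subr0 => /andP[_ /eqP sx].
  apply: le_trans (local_weight_le s xF) _; rewrite sx (negbTE oxz) add0r.
  rewrite big1 ?add0r // => v /andP[]; rewrite !inE => /orP[-> //|/eqP-> zx].
  by rewrite /defect eq_sym (negbTE zx) eq_sym (negbTE oxz).
- move=> s _ _; apply: le_trans (ler_dist_exp _ _ t01) _.
  rewrite !natrD mulr0 addr0; apply: eq_ler; congr `|_|; ring.
Qed.

(** The half-edges of a possible double edge between two distinct vertices,
    with edges [{x, z}] and [{y, w}]. *)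
Definition double_ends x y z w := [&& sb x y, sb z w & own z != own x].

Lemma uniq_double_ends x y z w : double_ends x y z w -> uniq (ends_of [:: (y, w); (x, z)]).
Proof.
case/and3P=> /andP[xy /eqP oxy] /andP[zw /eqP ozw] ozx.
rewrite !uniq_ends_cons /= !inE !negb_or !andbT.
have h a b : own a != own b -> a != b by apply: contraNneq => ->.
rewrite [y == x]eq_sym xy [w == z]eq_sym zw !h //; first by rewrite eq_sym.
- by rewrite -ozw.
- by rewrite -oxy eq_sym.
- by rewrite -oxy -ozw eq_sym.
Qed.

(** The second switch creates an edge parallel to [{x, z}], which adds 4 to the
    weight. *)
Lemma switch_second x y z w : double_ends x y z w ->
  `|mean [:: (y, w); (x, z)] (fun s => t ^+ (W s).-1)
    - mean [:: (x, z)] (fun s => t ^+ (W s + 3))|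
    <= 12 * bt + 4 * (2 * Delta%:R ^+ 2 / M).
Proof.
move=> d; have u := uniq_double_ends d.
case/and3P: d => /andP[xy /eqP oxy] /andP[zw /eqP ozw] ozx.
have yF : y \in ends_of [:: (y, w); (x, z)] by rewrite mem_head.
have sE s : extends [:: (y, w); (x, z)] s -> s x = z /\ s y = w.
  by rewrite !extends_cons => /andP[/andP[_ /eqP-> ] /eqP->].
have dyx s : extends [:: (y, w); (x, z)] s -> defect own s y x = 1%N.
  by case/sE=> sx sy; rewrite /defect eq_sym (negbTE xy) sx sy -oxy ozw -ozw ozx !eqxx.
apply: (mean_switch_weight owned T_large (c := 1) (phi := fun m => t ^+ m.-1)
   (psi := fun m => t ^+ (m + 3)) u) => //.
- by move=> s /dyx; rewrite /local_weight (bigD1 x) //= => ->; lia.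
- apply: le_trans (mean_defect_out_le R owned T_large u _ (y := w) _ yF) => //; last first.
    by move=> s /sE[].
  apply: le_mean => s sF; have [sx sy] := sE s sF.
  rewrite lerBlDl; apply: le_trans (local_weight_le s yF) _; rewrite lerD2r.
  rewrite sy -oxy -ozw (negbTE ozx) add0r.
  (* Among the ends of F only x, the end of the edge made parallel, counts. *)
  apply: le_trans (_ : \sum_(v | v == x) 1 <= _); last by rewrite big_pred1_eq.
  rewrite [leRHS]big_mkcond [leLHS]big_mkcond; apply: ler_sum => v _.
  rewrite !inE; have [->|vx] := eqVneq v x.
    by rewrite dyx //; case: ifP.
  case: ifP => // /andP[vF vy]; rewrite (negbTE vy) /= in vF.
  rewrite /defect eq_sym (negbTE vy) -oxy.
  by case/orP: vF => /eqP->; rewrite -?ozw eq_sym (negbTE ozx).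
- move=> s _ W1; apply: le_trans (ler_dist_exp _ _ t01) _; rewrite -/(W _).
  by rewrite -subn1 natrB // natrD mulr1; apply: eq_ler; congr `|_|; ring.
Qed.

Lemma switch_double x y z w : double_ends x y z w ->
  `|mean [:: (y, w); (x, z)] (fun s => t ^+ (W s).-1)
    - mean [::] (fun s => t ^+ (W s + 3))|
    <= 24 * bt + 16 * (Delta%:R ^+ 2 / M).
Proof.
move=> d; have h1 := switch_second d; have /and3P[_ _ ozx] := d.
have h2 := switch_first ozx; apply: le_trans (ler_distD _ _ _) _.
by apply: le_trans (lerD h1 h2) _; apply: eq_ler; ring.
Qed.

End Derivative.

(** * The derivative of the generating function of the weight *)

Section Rate.
Variables (R : realFieldType) (T : finType) (V : eqType) (own : T -> V).
Variable Delta : nat.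
Hypothesis owned : forall a, (#|[pred y | own y == a]| <= Delta)%N.
Hypothesis T_large : (14 <= #|T|)%N.
Implicit Types (s : {perm T}) (F : seq (T * T)) (x y z w u v : T).

Let M : R := #|T|%:R.
Let W s := weight own s.
Let bt : R := local_bound R own Delta.
Let sb := siblings own.
Let dl := double_ends own.
Let S : R := num_siblings R own.

Let M_ge14 : 14 <= M. Proof. by rewrite ler_nat. Qed.

Definition num_double_ends : R := \sum_x \sum_y \sum_z \sum_w (dl x y z w)%:R.

(** The mean of [weight], as a sum over the possible loops and double edges;
    it is close to [4 * (Lambda + Lambda ^ 2)]. *)
Definition rate : R := 2 * S / (M - 1) + num_double_ends / ((M - 1) * (M - 3)).

(** The weight as a sum of indicators of the presence of one or two given
    edges; this is what makes conditioning on edges appear. *)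
Lemma weight_expand s : matching s ->
  (W s)%:R = \sum_x \sum_y (sb x y)%:R * (2 * (s x == y)%:R)
    + \sum_x \sum_y \sum_z \sum_w (dl x y z w)%:R * ((s x == z)%:R * (s y == w)%:R) :> R.
Proof.
case/matchingP=> s1 sI; rewrite /W /weight /weight_in natr_sum -big_split /=.
apply: eq_bigr => x _; rewrite natr_sum.
have pick1 a (f : T -> R) : \sum_y f y * (a == y)%:R = f a.
  rewrite (bigD1 a) //= eqxx mulr1 big1 ?addr0 // => y ya.
  by rewrite eq_sym (negbTE ya) mulr0.
have -> : \sum_y (sb x y)%:R * (2 * (s x == y)%:R) = 2 * (own (s x) == own x)%:R :> R.
  under eq_bigr do rewrite mulrA.
  by rewrite pick1 /sb /siblings eq_sym s1 eq_sym mulrC.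
have -> : \sum_y \sum_z \sum_w (dl x y z w)%:R * ((s x == z)%:R * (s y == w)%:R)
    = \sum_y (dl x y (s x) (s y))%:R :> R.
  apply: eq_bigr => y _; transitivity (\sum_z (dl x y z (s y))%:R * (s x == z)%:R : R).
    by apply: eq_bigr => z _; under eq_bigr do rewrite mulrA; rewrite pick1.
  by rewrite pick1.
rewrite (bigD1 x) //= [in RHS](bigD1 x) //= addrA; congr (_ + _).
  by rewrite /dl /double_ends /siblings eqxx addr0 mul1n /defect eqxx -mul2n natrM.
apply: eq_bigr => y yx.
rewrite mul1n /defect /dl /double_ends /siblings (inj_eq perm_inj) [x == y]eq_sym (negbTE yx) /=.
by do ! case: (_ == _).
Qed.

Variable t : R.
Hypothesis t01 : 0 <= t <= 1.

Let left0 : free_mates R ([::] : seq (T * T)) = M - 1.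
Proof. by rewrite /free_mates natrB //; apply: leq_trans T_large. Qed.

Let left1 x z : free_mates R [:: (x, z)] = M - 3.
Proof. by rewrite /free_mates natrB //; apply: leq_trans T_large. Qed.

Let G := mean [::] (fun s => t ^+ (W s + 3)).

(** In the expansion of the weight each possible structure contributes its
    probability times the mean of [t ^+ (W s).-1] conditioned on its presence,
    which the switches compare with the unconditioned mean of
    [t ^+ (W s + 3)]. *)
Lemma derivative_bound :
  `|mean [::] (fun s => (W s)%:R * t ^+ (W s).-1) - rate * G|
    <= rate * (24 * bt + 16 * (Delta%:R ^+ 2 / M)).
Proof.
have Mge := M_ge14.
have bt0 : 0 <= bt by exact: local_bound_ge0.
have e0 : 0 <= Delta%:R ^+ 2 / M by rewrite divr_ge0 // exprn_ge0.
pose phi s := t ^+ (W s).-1; set eta := 24 * bt + _.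
have -> : mean [::] (fun s => (W s)%:R * t ^+ (W s).-1) =
    \sum_x \sum_y (sb x y)%:R * (2 / (M - 1)) * mean [:: (x, y)] phi
    + \sum_x \sum_y \sum_z \sum_w (dl x y z w)%:R / ((M - 1) * (M - 3))
        * mean [:: (y, w); (x, z)] phi.
  rewrite (@eq_mean _ _ _ _ (fun s => \sum_x \sum_y ((sb x y)%:R * 2) * ((s x == y)%:R * phi s)
    + \sum_x \sum_y \sum_z \sum_w (dl x y z w)%:R * ((s x == z)%:R * ((s y == w)%:R * phi s)))).
    rewrite meanD !mean_sum; congr (_ + _); apply: eq_bigr => x _; rewrite mean_sum; apply: eq_bigr => y _.
      rewrite meanZ; have [xy|_] := boolP (sb x y); last by rewrite !mul0r.
      have xny : x != y by case/andP: xy.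
      rewrite mean_edge ?left0; first by rewrite -!mulrA.
      by rewrite uniq_ends_cons xny.
    rewrite mean_sum; apply: eq_bigr => z _; rewrite mean_sum; apply: eq_bigr => w _.
    rewrite meanZ; have [d|_] := boolP (dl x y z w); last by rewrite !mul0r.
    have u := uniq_double_ends d; have u' : uniq (ends_of [:: (x, z)]).
      by move: u; rewrite uniq_ends_cons => /and4P[].
    by rewrite mean_edge // left0 mean_edge // left1 !mul1r invfM mulrA.
  move=> s; rewrite extends_nil -/(phi s) => ms; rewrite weight_expand // mulrDl; congr (_ + _).
    rewrite mulr_suml; apply: eq_bigr => x _; rewrite mulr_suml; apply: eq_bigr => y _; ring.
  rewrite mulr_suml; apply: eq_bigr => x _; rewrite mulr_suml; apply: eq_bigr => y _.
  rewrite mulr_suml; apply: eq_bigr => z _; rewrite mulr_suml; apply: eq_bigr => w _; ring.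
have rE c : rate * c = \sum_x \sum_y (sb x y)%:R * (2 / (M - 1)) * c
    + \sum_x \sum_y \sum_z \sum_w (dl x y z w)%:R / ((M - 1) * (M - 3)) * c.
  rewrite /rate mulrDl; congr (_ + _).
    rewrite [2 * S]mulrC -[S * 2 / _]mulrA /S /num_siblings !mulr_suml; apply: eq_bigr => x _.
    by rewrite !mulr_suml.
  rewrite /num_double_ends !mulr_suml; apply: eq_bigr => x _; rewrite !mulr_suml; apply: eq_bigr => y _.
  by rewrite !mulr_suml; apply: eq_bigr => z _; rewrite !mulr_suml.
rewrite !rE [- (\sum_x _ + _)]opprD addrACA; apply: le_trans (ler_normD _ _) _.
have lsum (I : finType) (f g h : I -> R) : (forall i, `|f i - g i| <= h i) ->
    `|\sum_i f i - \sum_i g i| <= \sum_i h i.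
  by move=> fg; rewrite -sumrB; apply: le_trans (ler_norm_sum _ _ _) _; apply: ler_sum.
have M1 : 0 <= M - 1 by rewrite subr_ge0; lra.
have M3 : 0 <= M - 3 by rewrite subr_ge0; lra.
have c1 : 0 <= 2 / (M - 1) by apply: divr_ge0.
have c2 : 0 <= ((M - 1) * (M - 3))^-1 by rewrite invr_ge0 mulr_ge0.
apply: lerD; apply: (lsum T) => x; apply: (lsum T) => y.
  rewrite -mulrBr normrM [`|_ * _|]ger0_norm ?(mulr_ge0 _ c1) //.
  have [xy|_] := boolP (sb x y); last by rewrite !mul0r.
  rewrite ler_wpM2l ?(mulr_ge0 _ c1) //.
  apply: le_trans (switch_loop owned T_large t01 xy) _.
  by rewrite /eta -/bt; lra.
apply: (lsum T) => z; apply: (lsum T) => w.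
rewrite -mulrBr normrM [`|_ / _|]ger0_norm ?(mulr_ge0 _ c2) //.
have [d|_] := boolP (dl x y z w); last by rewrite !mul0r.
rewrite ler_wpM2l ?(mulr_ge0 _ c2) //.
exact: switch_double.
Qed.

End Rate.

Section RateEstimate.
Variables (R : realFieldType) (T : finType) (V : eqType) (own : T -> V).
Variable Delta : nat.
Hypothesis owned : forall a, (#|[pred y | own y == a]| <= Delta)%N.
Hypothesis T_large : (14 <= #|T|)%N.

Let M : R := #|T|%:R.
Let S : R := num_siblings R own.
Let sigma : R := S / M.
Let D : R := Delta%:R.
Let N2 : R := num_double_ends R own.

Let M_ge14 : 14 <= M. Proof. by rewrite ler_nat. Qed.
Let S_ge0 : 0 <= S. Proof. exact: num_siblings_ge0. Qed.

Let D_ge1 : 1 <= D.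
Proof.
have /card_gt0P[x _] : (0 < #|T|)%N by apply: leq_trans T_large.
rewrite ler1n; apply: leq_trans (owned (own x)); apply/card_gt0P; exists x.
by rewrite inE.
Qed.

Lemma num_double_ends_le : N2 <= S ^+ 2.
Proof.
rewrite /N2 /num_double_ends expr2 {1}/S /num_siblings mulr_suml; apply: ler_sum => x _.
rewrite mulr_suml; apply: ler_sum => y _; rewrite mulr_sumr; apply: ler_sum => z _.
rewrite mulr_sumr; apply: ler_sum => w _; rewrite -natrM mulnb ler_nat /double_ends.
by do ! case: (siblings _ _ _) => //=; case: (_ != _).
Qed.

(** Dropping the condition that the two vertices of a double edge differ adds,
    for each pair of siblings, at most [Delta ^ 2] other pairs at the same
    vertex. *)
Lemma num_double_ends_ge : S ^+ 2 - D ^+ 2 * S <= N2.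
Proof.
rewrite lerBlDr /N2 /num_double_ends expr2 {1 3}/S /num_siblings mulr_suml mulr_sumr -big_split /=.
apply: ler_sum => x _; rewrite mulr_suml mulr_sumr -big_split /=.
apply: ler_sum => y _; have [xy|nxy] := boolP (siblings own x y); last first.
  by rewrite mul0r mulr0 addr0; do 2 (apply: sumr_ge0 => ? _).
rewrite mul1r mulr1; apply: le_trans (_ : \sum_z
   (\sum_w (double_ends own x y z w)%:R + (own z == own x)%:R * D) <= _).
  apply: ler_sum => z _.
  apply: le_trans (_ : \sum_w ((double_ends own x y z w)%:R
      + (own z == own x)%:R * (siblings own z w)%:R) <= _).
    apply: ler_sum => w _; rewrite -natrM -natrD ler_nat /double_ends xy /=.
    by case: (siblings _ z w) => //=; case: (_ == _).
  rewrite big_split /= lerD2l -mulr_sumr ler_wpM2l // -natr_sum ler_nat.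
  by rewrite -big_mkcond sum1_card (card_siblings owned).
rewrite big_split /= lerD2l.
rewrite -mulr_suml expr2 ler_wpM2r // -natr_sum ler_nat -big_mkcond sum1_card.
exact: owned.
Qed.

Let eps : R := D ^+ 2 / M.

Lemma rate_le : rate R own <= 4 * sigma + 4 * sigma ^+ 2.
Proof.
have Mge := M_ge14; have M0 : 0 < M by lra.
have M1 : 0 < M - 1 by lra.
have M3 : 0 < M - 3 by lra.
rewrite /rate -/M -/S -/N2; apply: lerD.
  rewrite ler_pdivrMr // -subr_ge0.
  have -> : 4 * sigma * (M - 1) - 2 * S = 2 * S * (M - 2) / M.
    by rewrite /sigma; field; rewrite gt_eqF.
  by apply: divr_ge0; [apply: mulr_ge0; [apply: mulr_ge0|lra]|lra].
have M13 : 0 < (M - 1) * (M - 3) by apply: mulr_gt0.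
rewrite ler_pdivrMr //; apply: le_trans num_double_ends_le _.
rewrite -subr_ge0.
have -> : 4 * sigma ^+ 2 * ((M - 1) * (M - 3)) - S ^+ 2 =
   S ^+ 2 * (3 * M ^+ 2 - 16 * M + 12) / M ^+ 2.
  by rewrite /sigma; field; rewrite gt_eqF.
apply: divr_ge0; last by rewrite exprn_ge0 // ltW.
by apply: mulr_ge0; [rewrite exprn_ge0|nra].
Qed.

(** As [sigma] is [2 * Lambda], the number [2 * sigma + sigma ^ 2] is
    [4 * (Lambda + Lambda ^ 2)]. *)
Lemma rate_dist :
  `|rate R own - (2 * sigma + sigma ^+ 2)| <= eps * (5 * sigma + 16 * sigma ^+ 2).
Proof.
have Mge := M_ge14; have M0 : 0 < M by lra.
have M1 : 0 < M - 1 by lra.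
have M3 : 0 < M - 3 by lra.
have M13 : 0 < (M - 1) * (M - 3) by apply: mulr_gt0.
have MV : M^-1 <= eps.
  by rewrite -[leLHS]mul1r /eps ler_wpM2r ?invr_ge0 ?(ltW M0) // expr_ge1.
have s0 : 0 <= sigma by rewrite /sigma divr_ge0 // ltW.
have s2 : 0 <= sigma ^+ 2 by rewrite exprn_ge0.
have l1 : 0 <= 2 * S / (M - 1) - 2 * sigma <= 4 * sigma / M.
  apply/andP; split; rewrite -subr_ge0.
    have -> : 2 * S / (M - 1) - 2 * sigma - 0 = 2 * S / (M * (M - 1)).
      by rewrite /sigma; field; rewrite !gt_eqF.
    by rewrite divr_ge0 ?mulr_ge0 // ltW.
  have -> : 4 * sigma / M - (2 * S / (M - 1) - 2 * sigma) = 2 * S * (M - 2) / (M ^+ 2 * (M - 1)).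
    by rewrite /sigma; field; rewrite !gt_eqF.
  by rewrite divr_ge0 ?mulr_ge0 ?exprn_ge0 ?(ltW M0) ?(ltW M1) //; lra.
have l2 : N2 / ((M - 1) * (M - 3)) - sigma ^+ 2 <= 16 * sigma ^+ 2 / M.
  apply: le_trans (_ : S ^+ 2 / ((M - 1) * (M - 3)) - sigma ^+ 2 <= _).
    by rewrite lerD2r ler_wpM2r ?num_double_ends_le // invr_ge0 ltW.
  rewrite -subr_ge0.
  have -> : 16 * sigma ^+ 2 / M - (S ^+ 2 / ((M - 1) * (M - 3)) - sigma ^+ 2) =
    S ^+ 2 * (12 * M ^+ 2 - 61 * M + 48) / (M ^+ 3 * ((M - 1) * (M - 3))).
    by rewrite /sigma; field; rewrite !gt_eqF.
  rewrite divr_ge0 ?mulr_ge0 ?exprn_ge0 ?(ltW M0) ?(ltW M1) ?(ltW M3) //; nra.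
have l3 : - (eps * sigma) <= N2 / ((M - 1) * (M - 3)) - sigma ^+ 2.
  apply: le_trans (_ : N2 / M ^+ 2 - sigma ^+ 2 <= _); last first.
    rewrite lerD2r; apply: ler_wpM2l.
      by do 4 (apply: sumr_ge0 => ? _).
    rewrite lef_pV2 ?posrE ?exprn_gt0 //; nra.
  apply: le_trans (_ : (S ^+ 2 - D ^+ 2 * S) / M ^+ 2 - sigma ^+ 2 <= _).
    have -> : (S ^+ 2 - D ^+ 2 * S) / M ^+ 2 - sigma ^+ 2 = - (eps * sigma).
      by rewrite /eps /sigma; field; rewrite gt_eqF.
    by [].
  by rewrite lerD2r ler_wpM2r ?num_double_ends_ge // invr_ge0 exprn_ge0 // ltW.
have m1 : 4 * sigma / M <= eps * (4 * sigma).
  by rewrite mulrC ler_wpM2r // mulr_ge0.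
have m2 : 16 * sigma ^+ 2 / M <= eps * (16 * sigma ^+ 2).
  by rewrite mulrC ler_wpM2r // mulr_ge0.
have ep : 0 <= eps by apply: le_trans MV; rewrite invr_ge0 ltW.
have e0 : 0 <= eps * sigma by apply: mulr_ge0.
have e1 : 0 <= eps * (16 * sigma ^+ 2) by apply: mulr_ge0 => //; apply: mulr_ge0.
case/andP: l1 => l1 l1'; rewrite /rate -/M -/S -/N2 ler_norml mulrDr.
by apply/andP; split; lra.
Qed.

(** The left-hand side bounds the gap between the derivative of the generating
    function and [4 * lam * t ^ 3] times the function.  Terms of order
    [D / M] and [1 / M] are absorbed in [D ^ 2 / M], since [D] is at least 1;
    the constant 1100 is not optimised. *)
Lemma total_error_le :
  rate R own * (24 * local_bound R own Delta + 16 * (D ^+ 2 / M))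
    + `|rate R own - (2 * sigma + sigma ^+ 2)|
  <= 1100 * (1 + sigma) ^+ 3 * eps.
Proof.
have Mge := M_ge14; have M0 : 0 < M by lra.
have s0 : 0 <= sigma by rewrite /sigma divr_ge0 // ltW.
have e0 : 0 <= eps by rewrite divr_ge0 ?exprn_ge0 // ltW.
have bE : local_bound R own Delta = (10 + 4 * sigma) * (D / M).
  by rewrite /local_bound -/M -/S -/D /sigma; field; rewrite gt_eqF.
have De : D / M <= eps.
  by rewrite /eps ler_wpM2r ?invr_ge0 ?(ltW M0) // expr2 ler_peMr.
have b1 : local_bound R own Delta <= (10 + 4 * sigma) * eps.
  by rewrite bE ler_wpM2l //; lra.
have b0 : 0 <= local_bound R own Delta by exact: local_bound_ge0.
have h2 : 24 * local_bound R own Delta + 16 * eps <= (256 + 96 * sigma) * eps by nra.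
apply: le_trans (_ : (4 * sigma + 4 * sigma ^+ 2) * ((256 + 96 * sigma) * eps)
   + eps * (5 * sigma + 16 * sigma ^+ 2) <= _).
  apply: lerD; last exact: rate_dist.
  apply: le_trans (_ : (4 * sigma + 4 * sigma ^+ 2) * (24 * local_bound R own Delta + 16 * eps) <= _).
    by rewrite ler_wpM2r ?rate_le // addr_ge0 // mulr_ge0.
  by rewrite ler_wpM2l //; apply: addr_ge0; apply: mulr_ge0 => //; exact: exprn_ge0.
have cubic : (4 * sigma + 4 * sigma ^+ 2) * (256 + 96 * sigma)
    + (5 * sigma + 16 * sigma ^+ 2) <= 1100 * (1 + sigma) ^+ 3.
  by have q2 := exprn_ge0 2 s0; have q3 := exprn_ge0 3 s0; lra.
apply: le_trans (ler_wpM2r e0 cubic); apply: eq_ler; ring.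
Qed.

End RateEstimate.

(** * The Poisson approximation *)

(** The mean value theorem for [p * exp q], whose derivative is
    [(p' + p * q') * exp q], where [exp q] is at most 1. *)
Lemma interpolation (R : realType) (p q : {poly R}) (eta : R) :
  (forall t : R, 0 <= t <= 1 -> q.[t] <= 0) ->
  (forall t : R, 0 <= t <= 1 -> `|p^`().[t] + p.[t] * q^`().[t]| <= eta) ->
  `|p.[1] * expR q.[1] - p.[0] * expR q.[0]| <= eta.
Proof.
move=> q0 pq.
pose h : R -> R := horner p * (expR \o horner q).
have hE t : h t = p.[t] * expR q.[t] by [].
have dh (t : R) : is_derive t (1 : R) h ((p^`().[t] + p.[t] * q^`().[t]) * expR q.[t]).
  apply: is_derive_eq; rewrite /= ![_ *: _]mulrC; ring.
have ch : {within `[(0 : R), 1], continuous h}%classic.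
  by apply: derivable_within_continuous => t _; case: (dh t).
have [c c01] := MVT (@ltr01 R) (fun t _ => dh t) ch.
rewrite !hE subr0 mulr1 => ->.
have {}c01 : 0 <= c <= 1 by move: c01; rewrite in_itv /= => /andP[? ?]; rewrite !ltW.
rewrite normrM [`|expR _|]ger0_norm ?expR_ge0 //.
apply: le_trans (pq c c01); rewrite ler_piMr // -expR0 ler_expR; exact: q0.
Qed.

Section PoissonLimit.
Variables (R : realType) (T : finType) (V : eqType) (own : T -> V).
Variable Delta : nat.
Hypothesis owned : forall a, (#|[pred y | own y == a]| <= Delta)%N.
Hypothesis T_large : (14 <= #|T|)%N.
Hypothesis T_even : ~~ odd #|T|.
Implicit Types (s : {perm T}) (F : seq (T * T)) (x y z w u v : T).

Let M : R := #|T|%:R.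
Let W s := weight own s.
Let S : R := num_siblings R own.
Let sigma : R := S / M.
Let D : R := Delta%:R.

Let M_ge14 : 14 <= M. Proof. by rewrite ler_nat. Qed.

Definition prob_weight0 : R := mean [::] (fun s => (weight own s == 0%N)%:R).

(** The probability generating function of the weight. *)
Let pgf : {poly R} := (#|extends ([::] : seq (T * T))|%:R)^-1 *: \sum_(s | extends [::] s) 'X^(W s).

Let pgfE t : pgf.[t] = mean [::] (fun s => t ^+ W s).
Proof.
rewrite /pgf hornerZ horner_sum /mean mulrC; congr (_ * _).
by apply: eq_bigr => s _; rewrite hornerXn.
Qed.

Let pgf'E t : pgf^`().[t] = mean [::] (fun s => (W s)%:R * t ^+ (W s).-1).
Proof.
rewrite /pgf derivZ hornerZ raddf_sum horner_sum /mean mulrC; congr (_ * _).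
by apply: eq_bigr => s _; rewrite /= derivXn hornerMn hornerXn mulr_natl.
Qed.

(** [interpolation] applies to the generating function and to
    [- lam * 'X^4], with [lam = Lambda + Lambda ^ 2]: the generating function
    is 1 at 1, and at 0 it is the probability that the weight vanishes. *)
Lemma poisson_approx :
  `|prob_weight0 - expR (- (sigma / 2 + (sigma / 2) ^+ 2))|
    <= 1100 * (1 + sigma) ^+ 3 * (D ^+ 2 / M).
Proof.
have Mge := M_ge14; have M0 : 0 < M by lra.
have s0 : 0 <= sigma by rewrite /sigma divr_ge0 ?num_siblings_ge0 // ltW.
set lam := sigma / 2 + (sigma / 2) ^+ 2.
have lam0 : 0 <= lam by rewrite addr_ge0 ?exprn_ge0 // divr_ge0.
have lamE : 2 * sigma + sigma ^+ 2 = 4 * lam by rewrite /lam; field.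
pose q : {poly R} := - (lam *: 'X^4).
have qE t : q.[t] = - (lam * t ^+ 4) by rewrite hornerN hornerZ hornerXn.
have q'E t : q^`().[t] = - (4 * lam * t ^+ 3).
  by rewrite derivN hornerN derivZ hornerZ derivXn hornerMn hornerXn -mulr_natl mulrCA mulrA.
have := @interpolation R pgf q (1100 * (1 + sigma) ^+ 3 * (D ^+ 2 / M)) _ _.
rewrite !qE !pgfE expr1n expr0n /= mulr1 mulr0 oppr0 expR0 mulr1 distrC.
have -> : mean [::] (fun s => 1 ^+ W s) = 1 :> R.
  rewrite -[RHS](mean1 R (matching_exists T_even)).
  by apply: eq_mean => s _; rewrite expr1n.
rewrite mul1r; have -> : mean [::] (fun s => 0 ^+ W s) = prob_weight0.
  by apply: eq_mean => s _; rewrite expr0n.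
apply=> [t /andP[t0 t1]|t t01].
  by rewrite qE oppr_le0 mulr_ge0 // exprn_ge0.
rewrite pgf'E pgfE q'E.
apply: le_trans (total_error_le R owned T_large).
rewrite -/M -/S -/sigma -/D lamE; set G := mean _ _; set A := mean _ _.
pose G3 := mean [::] (fun s => t ^+ (W s + 3)).
have G3E : G3 = t ^+ 3 * A by rewrite -meanZ; apply: eq_mean => s _; rewrite exprD mulrC.
have G301 : 0 <= G3 <= 1.
  case/andP: t01 => t0 t1; apply/andP; split.
    by apply: mean_ge0 => s _; rewrite exprn_ge0.
  apply: le_trans (mean_1_le1 R [::]); apply: le_mean => s _; exact: exprn_ile1.
have -> : G + A * - (4 * lam * t ^+ 3) = (G - rate R own * G3) + (rate R own - 4 * lam) * G3.
  by rewrite G3E; ring.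
apply: le_trans (ler_normD _ _) _; apply: lerD; first exact: derivative_bound.
rewrite normrM ler_piMr //; case/andP: G301 => g0 g1; by rewrite ger0_norm.
Qed.

End PoissonLimit.

(** * Chebyshev's inequality for the loops *)

Section SecondMoment.
Variables (R : realFieldType) (T : finType) (V : eqType) (own : T -> V).
Hypothesis T_large : (14 <= #|T|)%N.
Hypothesis T_even : ~~ odd #|T|.
Implicit Types (s : {perm T}) (F : seq (T * T)) (x y z w u v : T).

Let M : R := #|T|%:R.
Let sb := siblings own.
Let S : R := num_siblings R own.
Let mu : R := S / (M - 1).

Let M_ge14 : 14 <= M. Proof. by rewrite ler_nat. Qed.

Let left0 : free_mates R ([::] : seq (T * T)) = M - 1.
Proof. by rewrite /free_mates natrB //; apply: leq_trans T_large. Qed.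

Let left1 x z : free_mates R [:: (x, z)] = M - 3.
Proof. by rewrite /free_mates natrB //; apply: leq_trans T_large. Qed.

Let M1_gt0 : 0 < M - 1. Proof. have := M_ge14; lra. Qed.
Let M3_gt0 : 0 < M - 3. Proof. have := M_ge14; lra. Qed.

(** The number of loops, each counted twice. *)
Let loops s : R := \sum_x \sum_y (sb x y)%:R * (s x == y)%:R.

Let sb_neq x y : sb x y -> uniq (ends_of [:: (x, y)]).
Proof. by case/andP=> xy _; rewrite uniq_ends_cons xy. Qed.

Let mean_loops : mean [::] loops = mu.
Proof.
rewrite /mu /S /num_siblings mulr_suml mean_sum; apply: eq_bigr => x _.
rewrite mulr_suml mean_sum; apply: eq_bigr => y _; rewrite meanZ.
rewrite -/(sb x y); have [xy|_] := boolP (sb x y); last by rewrite !mul0r.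
have u := sb_neq xy; rewrite !mul1r.
rewrite (@eq_mean _ _ _ _ (fun s => (s x == y)%:R * 1)) => [|s _]; last by rewrite mulr1.
rewrite mean_edge // left0 mean1 ?mulr1 //.
by have /andP[] := card_extends_gt0 R u (matching_exists T_even).
Qed.

(** Two ordered pairs of mates are disjoint, or equal up to order, or cannot
    occur together. *)
Let mean_two_loops x y z w : sb x y -> sb z w ->
  mean [::] (fun s => (s x == y)%:R * (s z == w)%:R) <=
    ((M - 1) * (M - 3))^-1
    + (M - 1)^-1 * (((z == x) && (w == y))%:R + ((z == y) && (w == x))%:R).
Proof.
move=> xy zw; have u := sb_neq xy; rewrite mean_edge // left0.
have i1 : 0 <= (M - 1)^-1 by rewrite invr_ge0 ltW.
have i3 : 0 <= (M - 3)^-1 by rewrite invr_ge0 ltW.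
rewrite invfM -mulrDr ler_wpM2l //.
have [zF|zF] := boolP (z \in ends_of [:: (x, y)]); last first.
  apply: ler_wpDr; first by rewrite addr_ge0.
  by rewrite -(left1 x y); exact: prob_edge_inv_le.
apply: ler_wpDl => //.
apply: le_trans (_ : mean [:: (x, y)] (fun=>
    (((z == x) && (w == y))%:R + ((z == y) && (w == x))%:R) * 1) <= _).
  apply: le_mean => s; rewrite extends_cons => /andP[sm /eqP sx].
  have /matchingP[_ sI] := extends_matching sm; rewrite mulr1 -natrD ler_nat.
  move: zF; rewrite !inE => /orP[] /eqP->; rewrite eqxx /=.
    by rewrite sx eq_sym leq_addr.
  by rewrite -sx sI eq_sym leq_addl.
by rewrite meanZ ler_piMr ?mean_1_le1 // addr_ge0.
Qed.

Let mean_loops2 : mean [::] (fun s => loops s ^+ 2) <=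
  S ^+ 2 / ((M - 1) * (M - 3)) + 2 * mu.
Proof.
pose B x y z w : R := ((M - 1) * (M - 3))^-1
    + (M - 1)^-1 * (((z == x) && (w == y))%:R + ((z == y) && (w == x))%:R).
apply: le_trans (_ : \sum_x \sum_y \sum_z \sum_w (sb x y)%:R * (sb z w)%:R * B x y z w <= _).
  rewrite (@eq_mean _ _ _ _ (fun s => \sum_x \sum_y \sum_z \sum_w
      ((sb x y)%:R * (sb z w)%:R) * ((s x == y)%:R * (s z == w)%:R))); last first.
    move=> s _; rewrite expr2 mulr_suml; apply: eq_bigr => x _.
    rewrite mulr_suml; apply: eq_bigr => y _; rewrite mulr_sumr; apply: eq_bigr => z _.
    by rewrite mulr_sumr; apply: eq_bigr => w _; rewrite mulrACA.
  rewrite mean_sum; apply: ler_sum => x _; rewrite mean_sum; apply: ler_sum => y _.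
  rewrite mean_sum; apply: ler_sum => z _; rewrite mean_sum; apply: ler_sum => w _.
  rewrite meanZ; have [xy|_] := boolP (sb x y); last by rewrite !mul0r.
  have [zw|_] := boolP (sb z w); last by rewrite mulr0 !mul0r.
  by rewrite !mul1r; exact: mean_two_loops.
have pick x y (f : T -> T -> R) : \sum_z \sum_w f z w * ((z == x) && (w == y))%:R = f x y.
  rewrite (bigD1 x) //= (bigD1 y) //= !eqxx mulr1 big1 ?addr0 => [|w /negbTE wy]; last first.
    by rewrite wy mulr0.
  by rewrite big1 ?addr0 // => z /negbTE zx; apply: big1 => w _; rewrite zx mulr0.
have e1 x y : \sum_z \sum_w (sb x y)%:R * (sb z w)%:R * B x y z w =
    (sb x y)%:R * (S / ((M - 1) * (M - 3))) + (sb x y)%:R * (2 / (M - 1)).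
  have [xy|_] := boolP (sb x y); last first.
    by rewrite !mul0r addr0; apply: big1 => z _; apply: big1 => w _; rewrite !mul0r.
  have yx : sb y x by move: xy; rewrite /sb /siblings eq_sym [own x == _]eq_sym.
  pose f z w : R := (sb z w)%:R / (M - 1).
  transitivity (\sum_z \sum_w ((sb z w)%:R / ((M - 1) * (M - 3))
     + (f z w * ((z == x) && (w == y))%:R + f z w * ((z == y) && (w == x))%:R))).
    apply: eq_bigr => z _; apply: eq_bigr => w _; rewrite mul1r /B /f; ring.
  under eq_bigr do rewrite big_split /=.
  rewrite big_split /= !mul1r; congr (_ + _).
    by rewrite /S /num_siblings mulr_suml; apply: eq_bigr => z _; rewrite mulr_suml.
  under eq_bigr do rewrite big_split /=.
  by rewrite big_split /= !pick /f xy yx -mulrDl.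
under eq_bigr do under eq_bigr do rewrite e1.
under eq_bigr do rewrite big_split /=.
have SE c : \sum_x \sum_y (sb x y)%:R * c = S * c.
  by rewrite /S /num_siblings mulr_suml; apply: eq_bigr => x _; rewrite mulr_suml.
by rewrite big_split /= !SE; apply: eq_ler; rewrite /mu; ring.
Qed.

(** Chebyshev's inequality for [loops]: its mean is [mu] and its variance at
    most [2 * mu + 2 * mu ^ 2 / (M - 3)], while it is zero on matchings of
    weight zero. *)
Lemma prob_weight0_le : 0 < S ->
  mean [::] (fun s => (weight own s == 0%N)%:R) <= 2 * (M / S) + 4 / M.
Proof.
move=> S0; have Mge := M_ge14; have M0 : 0 < M by lra.
have mu0 : 0 < mu by rewrite divr_gt0.
set P := mean _ _.
have h1 : P * mu ^+ 2 <= mean [::] (fun s => loops s ^+ 2) - mu ^+ 2.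
  have -> : mean [::] (fun s => loops s ^+ 2) - mu ^+ 2
      = mean [::] (fun s => (loops s - mu) ^+ 2).
    rewrite (@eq_mean _ _ _ (fun s => (loops s - mu) ^+ 2)
       (fun s => loops s ^+ 2 + (- (2 * mu) * loops s + mu ^+ 2 * 1))); last first.
      by move=> s _; ring.
    rewrite !meanD !meanZ mean_loops mean1 ?matching_exists //; ring.
  rewrite /P mulrC -meanZ; apply: le_mean => s; rewrite extends_nil => sm.
  have [W0|_] := eqVneq; last by rewrite mulr0 sqr_ge0.
  suff -> : loops s = 0 by rewrite sub0r sqrrN mulr1.
  apply: big1 => x _; apply: big1 => y _.
  have [e|_] := eqVneq (s x) y; last by rewrite mulr0.
  suff -> : sb x y = false by rewrite mul0r.
  have := eqP (introT eqP W0); rewrite /weight /weight_in (bigD1 x) //= (bigD1 x) //=.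
  rewrite mul1n /defect eqxx e /sb /siblings [own x == _]eq_sym.
  by case: (own y == own x); rewrite ?andbF.
have h2 : P * mu ^+ 2 <= S ^+ 2 / ((M - 1) * (M - 3)) + 2 * mu - mu ^+ 2.
  by apply: le_trans h1 _; rewrite lerD2r; exact: mean_loops2.
have e : S ^+ 2 / ((M - 1) * (M - 3)) + 2 * mu - mu ^+ 2 =
    (2 * ((M - 1) / S) + 2 / (M - 3)) * mu ^+ 2.
  by rewrite /mu; field; rewrite !gt_eqF.
rewrite e ler_pM2r ?exprn_gt0 // in h2; apply: le_trans h2 _; apply: lerD.
  rewrite ler_wpM2l // ler_wpM2r ?invr_ge0 ?(ltW S0) //; lra.
by rewrite ler_pdivrMr // mulrAC ler_pdivlMr //; lra.
Qed.

End SecondMoment.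

(** * Pairings and involutions *)

Section Pairs.
Variable T : finType.
Implicit Types (s : {perm T}) (x y z : T).

Definition pairs_of s : {set {set T}} := [set [set x; s x]%SET | x in T].

Definition pairing (P : {set {set T}}) :=
  finset.partition P [set: T] && [forall B in P, #|B| == 2%N].

Lemma mem_pairs s x : [set x; s x]%SET \in pairs_of s.
Proof. by apply/imsetP; exists x. Qed.

Lemma pairs_of_mate s (B : {set T}) z : matching s -> B \in pairs_of s -> z \in B ->
  B = [set z; s z]%SET.
Proof.
case/matchingP=> _ sI /imsetP[x _ ->]; rewrite !inE => /orP[] /eqP-> //.
by rewrite sI finset.setUC.
Qed.

Lemma pairs_of_inj : {in @matching T &, injective pairs_of}.
Proof.
move=> s s' ms ms' ss'; apply/permP => x.
have /matchingP[s1 _] := ms; have /matchingP[s'1 _] := ms'.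
have := mem_pairs s x; rewrite ss' => h.
have /finset.setP/(_ (s x)) := pairs_of_mate ms' h (set21 _ _).
by rewrite !inE eqxx orbT (negbTE (s1 x)) => /esym/eqP.
Qed.

Lemma pairing_pairs_of s : matching s -> pairing (pairs_of s).
Proof.
move=> ms; have /matchingP[s1 sI] := ms; apply/andP; split.
  apply/and3P; split.
  - apply/eqP/finset.setP => x; rewrite inE; apply/bigcupP.
    by exists [set x; s x]%SET; rewrite ?mem_pairs ?set21.
  - apply/finset.trivIsetP => A B AP BP; apply: contraNT => /pred0Pn[z /= /andP[zA zB]].
    by rewrite (pairs_of_mate ms AP zA) (pairs_of_mate ms BP zB).
  - by apply/imsetP => -[x _ /finset.setP/(_ x)]; rewrite !inE eqxx.
apply/forall_inP => B /imsetP[x _ ->].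
by rewrite cards2 [x == _]eq_sym s1.
Qed.

(** The mate of [x] is the other element of the block of [x]. *)
Lemma pairing_pairs_of_ex (P : {set {set T}}) : pairing P ->
  exists2 s, matching s & P = pairs_of s.
Proof.
case/andP=> /and3P[/eqP cP tP P0] /forall_inP P2.
have xP x : x \in finset.cover P by rewrite cP inE.
have mate x : {y | y != x & finset.pblock P x = [set x; y]%SET}.
  apply: cid2.
  have /cards2P[a [b [ab Bab]]] := P2 _ (finset.pblock_mem (xP x)).
  have := xP x; rewrite -finset.mem_pblock Bab !inE => /orP[] /eqP->.
    by exists b; rewrite // eq_sym.
  by exists a; rewrite // finset.setUC.
pose m x := s2val (mate x).
have m1 x : m x != x := s2valP (mate x).
have mP x : finset.pblock P x = [set x; m x]%SET := s2valP' (mate x).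
have mI : involutive m.
  move=> x; have : finset.pblock P (m x) = finset.pblock P x.
    by apply/finset.same_pblock => //; rewrite mP set22.
  rewrite !mP => /finset.setP/(_ (m (m x))); rewrite !inE eqxx orbT.
  by rewrite (negbTE (m1 (m x))) orbF => /esym/eqP.
exists (perm (inv_inj mI)).
  by apply/matchingP; split=> x; rewrite !permE.
apply/finset.setP => B; apply/idP/imsetP => [BP|[x _ ->]].
  have /set0Pn[x xB] : B != finset.set0 by apply: contraNneq P0 => <-.
  by exists x; rewrite // permE -mP (finset.def_pblock tP BP xB).
by rewrite permE -mP finset.pblock_mem.
Qed.

Lemma card_pairings (Q : pred {set {set T}}) :
  #|[pred P | pairing P && Q P]| = #|[pred s | matching s && Q (pairs_of s)]|.
Proof.
rewrite -(card_in_imset (f := pairs_of)); last first.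
  by move=> s s' /andP[ms _] /andP[ms' _]; exact: pairs_of_inj.
apply: eq_card => P; apply/andP/imsetP => [[/pairing_pairs_of_ex[s ms ->] QP]|[s /andP[ms Qs] ->]].
  by exists s; rewrite // inE ms.
by split=> //; exact: pairing_pairs_of.
Qed.

End Pairs.

(** * The configuration model *)

Section Transfer.
Variables (R : realType) (n : nat) (d : 'I_n -> nat).

Let T : finType := half_edge d.
Let own : T -> 'I_n := @owner n d.

Lemma sum_half_edge (A : nmodType) (f : 'I_n -> A) :
  \sum_(x : T) f (own x) = \sum_(v < n) f v *+ d v.
Proof.
transitivity (\sum_(v < n) \sum_(j < d v) f v); last first.
  by apply: eq_bigr => v _; rewrite sumr_const card_ord.
by rewrite (sig_big_dep xpredT (fun _ => xpredT) (fun v _ => f v)).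
Qed.

Lemma card_half_edge : #|T| = (\sum_(v < n) d v)%N.
Proof.
rewrite -sum1_card; have := sum_half_edge (fun _ => 1%N : nat).
by move=> /= h; rewrite [LHS]h; apply: eq_bigr => v _; rewrite -mulr_natr mul1r natn.
Qed.

Lemma card_owned a : (#|[pred y : T | own y == a]| = d a)%N.
Proof.
rewrite -sum1_card big_mkcond /=.
have /= h := sum_half_edge (fun v => (v == a : nat)).
transitivity (\sum_(x : T) (own x == a : nat))%N.
  by apply: eq_bigr => x _; rewrite inE; case: (_ == _).
rewrite [LHS]h (bigD1 a) //= eqxx big1 => [|v /negbTE->]; last by rewrite mul0rn.
by rewrite addr0 natn.
Qed.

Lemma num_siblings_half_edge : num_siblings R own = 2 * \sum_(v < n) 'C(d v, 2)%:R.
Proof.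
rewrite /num_siblings; transitivity (\sum_(x : T) (d (own x)).-1%:R : R).
  apply: eq_bigr => x _; rewrite -natr_sum; congr (_%:R).
  rewrite -(card_owned (own x)) (cardD1 x) inE eqxx /= -sum1_card [RHS]big_mkcond /=.
  apply: eq_bigr => y _; rewrite !inE /siblings eq_sym [own x == _]eq_sym.
  by case: (_ && _).
rewrite (sum_half_edge (fun v => (d v).-1%:R)) mulr_sumr; apply: eq_bigr => v _.
by rewrite -[LHS]mulr_natr -!natrM -mul_bin_diag bin1 mulnC.
Qed.

(** A loop is a half-edge [x] with [own (s x) = own x].  If there are none,
    two distinct edges have the same ends exactly when one can name them
    [{x, s x}] and [{z, s z}] with [own x = own z] and
    [own (s x) = own (s z)]. *)
Lemma simple_weight (P : configuration d) (s : {perm T}) : matching s -> val P = pairs_of s ->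
  simple_multigraph (config_multigraph P) = (weight own s == 0%N).
Proof.
move=> ms Ps; have /matchingP[s1 sI] := ms.
have endsE x : own @: [set x; s x]%SET = [set own x; own (s x)]%SET.
  by rewrite imsetU !imset_set1.
have inP x : [set x; s x]%SET \in val P by rewrite Ps mem_pairs.
pose e x : config_edge P := Sub [set x; s x]%SET (inP x).
have eP (f : config_edge P) z : z \in val f -> f = e z.
  move=> zf; apply: val_inj => /=; apply: pairs_of_mate => //.
  by rewrite -Ps; exact: (valP f).
have ne (f : config_edge P) : exists z, z \in val f.
  have := valP f; move: (val f) => B; rewrite Ps.
  by move=> /imsetP[x _ ->]; exists x; rewrite set21.
have loopE x : is_loop (G := config_multigraph P) (e x) = (own x == own (s x)).
  by rewrite /is_loop /= /config_ends /= endsE cards2; case: (own x == _).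
apply/andP/eqP => [[/forallP nl /forallP np]|W0].
  have nl' x : own (s x) != own x by rewrite eq_sym -loopE; exact: nl.
  apply: big1 => u _; apply: big1 => v _; rewrite mul1n /defect.
  have [_|uv] := eqVneq u v; first by rewrite (negbTE (nl' u)).
  have [ouv|//] := eqVneq (own u) (own v).
  have [osuv|//] := eqVneq (own (s u)) (own (s v)).
  have /forallP/(_ (e v)) := np (e u); rewrite /parallel /= negb_and /config_ends /=.
  rewrite !endsE ouv osuv eqxx orbF negbK => /eqP/(congr1 val)/= /finset.setP/(_ v).
  rewrite !inE eqxx /= eq_sym (negbTE uv) /= => /eqP vsu.
  by have := nl' u; rewrite -vsu ouv eqxx.
have df u v : defect own s u v = 0%N.
  move: W0 => /eqP; rewrite /weight /weight_in sum_nat_eq0 => /forallP/(_ u).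
  by rewrite sum_nat_eq0 => /forallP/(_ v) /=; rewrite mul1n => /eqP.
have nl x : own (s x) != own x.
  by have := df x x; rewrite /defect eqxx; case: (_ == _).
split; apply/forallP => f.
  by have [z zf] := ne f; rewrite (eP f z zf) loopE eq_sym nl.
apply/forallP => g; have [x xf] := ne f; rewrite (eP f x xf) {f xf}.
apply/negP => /andP[/negP neg /eqP /= eg]; apply: neg; apply/eqP.
have : own x \in config_ends g by rewrite -eg /config_ends /= endsE set21.
case/imsetP => z zg oxz; rewrite (eP g z zg) in eg; have {}oxz : own x = own z := oxz.
move: eg; rewrite /config_ends /= !endsE => /finset.setP/(_ (own (s x))).
rewrite !inE eqxx orbT -oxz (negbTE (nl x)) /= => /esym/eqP osxz.
rewrite (eP g z zg); have [->//|xz] := eqVneq x z.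
by have := df x z; rewrite /defect (negbTE xz) oxz osxz !eqxx -osxz -oxz (nl x).
Qed.

Lemma prob_simpleE : prob_simple R d = prob_weight0 R own.
Proof.
have ->: prob_weight0 R own =
   #|[pred s : {perm T} | matching s && (weight own s == 0%N)]|%:R
   / #|[pred s : {perm T} | matching s]|%:R.
  rewrite /prob_weight0 /mean; congr (_ / _%:R); last first.
    by apply: eq_card => s; rewrite -[LHS]/(extends [::] s) extends_nil inE.
  rewrite -sum1_card natr_sum big_mkcond [RHS]big_mkcond /=; apply: eq_bigr => s _.
  by rewrite extends_nil inE; do 2 case: ifP => //=.
(* Simplicity in terms of the underlying set of pairs alone. *)
pose Q (P : {set {set T}}) := [exists s : {perm T}, [&& matching s, P == pairs_of s & weight own s == 0%N]].
have QE s : matching s -> Q (pairs_of s) = (weight own s == 0%N).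
  move=> ms; apply/existsP/idP => [[s' /and3P[ms' /eqP e w]]|w].
    by rewrite (pairs_of_inj ms ms' e).
  by exists s; rewrite ms eqxx.
(* Counting configurations amounts to counting the underlying sets of pairs. *)
have cardE (A : pred {set {set T}}) (B : pred (configuration d)) :
    (forall P : configuration d, B P = A (val P)) ->
    #|[pred P | pairing P && A P]| = #|B|.
  move=> AB; rewrite -(fintype.card_image (val_inj : injective (val : configuration d -> _)) B).
  apply: eq_card => P.
  apply/andP/fintype.imageP => [[cP AP]|[P' BP' ->]].
    by exists (Sub P cP) => //; rewrite unfold_in AB.
  by split; [exact: (valP P') | rewrite -AB].
rewrite /prob_simple /uniform_prob; congr (_%:R / _%:R).
  rewrite -(cardE Q); first rewrite (card_pairings Q); first apply: eq_card => s.
    by rewrite !inE; case: (boolP (matching s)) => //= /QE ->.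
  move=> P; have [s ms Ps] := pairing_pairs_of_ex (valP P).
  by rewrite /= (simple_weight ms Ps) Ps QE.
rewrite -(cardE xpredT) // card_pairings; apply: eq_card => s.
by rewrite !inE andbT.
Qed.

End Transfer.

(** * The limit *)

Section Quantitative.
Variables (R : realType) (n : nat) (d : 'I_n -> nat).
Hypothesis even_sum : ~~ odd (\sum_(i < n) d i)%N.

Let T : finType := half_edge d.
Let own : T -> 'I_n := @owner n d.
Let N := num_pairs d.
Let Delta := (\max_(i < n) d i)%N.
Let L : R := Lambda R d.

Let card_T : #|T| = (2 * N)%N.
Proof. by rewrite card_half_edge /N /num_pairs mul2n; exact/esym/even_halfK. Qed.

Let sigmaE : num_siblings R own / #|T|%:R = 2 * L.
Proof.
by rewrite num_siblings_half_edge card_T natrM /L /Lambda -/N mulrC mulrCA.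
Qed.

Lemma Lambda_sqr : (0 < N)%N ->
  L = (\sum_(i < n) (d i)%:R ^+ 2) / (4 * N%:R) - 2^-1.
Proof.
move=> N0; have Nn0 : N%:R != 0 :> R by rewrite pnatr_eq0 -lt0n.
have binE : 2 * \sum_(i < n) 'C(d i, 2)%:R = \sum_(i < n) (d i)%:R ^+ 2 - 2 * N%:R :> R.
  rewrite -natrM -card_T card_half_edge natr_sum -sumrB mulr_sumr.
  apply: eq_bigr => i _; rewrite -natrM -mul_bin_diag bin1 natrM.
  by case: (d i) => [|k]; rewrite /= ?mul0r ?expr2 ?mul0r ?subr0 // -natr1; ring.
rewrite /L /Lambda -/N; apply: (@mulfI _ 2) => //.
rewrite mulrCA binE; field; exact: Nn0.
Qed.

(** The two regimes are separated by the threshold [4 / eps] for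
    [2 * Lambda].  Below it [poisson_approx] applies, with a bounded factor in
    front of [Delta ^ 2 / N]; above it the probability and the exponential are
    both between 0 and [eps]. *)
Lemma prob_simple_approx (eps : R) : 0 < eps -> (7 <= N)%N -> 4 / eps <= N%:R ->
  1100 * (1 + 4 / eps) ^+ 3 * (Delta%:R ^+ 2 / (2 * N%:R)) <= eps ->
  `|prob_simple R d - expR (- L - L ^+ 2)| <= eps.
Proof.
move=> eps0 N7 Neps small; rewrite prob_simpleE.
have T_large : (14 <= #|T|)%N by rewrite card_T; lia.
have T_even : ~~ odd #|T| by rewrite card_T mul2n odd_double.
have owned a : (#|[pred y : T | own y == a]| <= Delta)%N.
  by rewrite (card_owned d a); exact: leq_bigmax.
have N0 : 0 < N%:R :> R by rewrite ltr0n; apply: leq_trans N7.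
have ME : #|T|%:R = 2 * N%:R :> R by rewrite card_T natrM.
have L0 : 0 <= 2 * L by rewrite -sigmaE divr_ge0 ?num_siblings_ge0.
have [Lbig|Lsmall] := ltP (4 / eps) (2 * L); last first.
  have := poisson_approx R owned T_large T_even.
  rewrite sigmaE ME [2 * L / 2]mulrAC divff // mul1r opprD => h.
  apply: le_trans h _; apply: le_trans small; apply: ler_wpM2r.
    by rewrite divr_ge0 ?exprn_ge0 // mulr_ge0 // ltW.
  apply: ler_wpM2l; first exact: ler0n.
  have e4 : 0 <= 4 / eps by rewrite divr_ge0 // ltW.
  by rewrite lerXn2r ?nnegrE ?addr_ge0 // lerD2l.
have L2 : 0 < 2 * L by apply: lt_trans Lbig; rewrite divr_gt0.
have S0 : 0 < num_siblings R own.
  by move: L2; rewrite -sigmaE pmulr_lgt0 // invr_gt0 ME mulr_gt0.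
have p0 : 0 <= prob_weight0 R own by apply: mean_ge0.
have e0 := expR_ge0 (- L - L ^+ 2).
have Linv : 2 / (2 * L) <= eps / 2.
  rewrite ler_pdivrMr // mulrAC ler_pdivlMr //.
  by move: Lbig; rewrite ltr_pdivrMr //; lra.
have Ninv : 4 / #|T|%:R <= eps / 2.
  rewrite ME ler_pdivrMr ?mulr_gt0 // mulrAC ler_pdivlMr //.
  by move: Neps; rewrite ler_pdivrMr //; lra.
have p1 : prob_weight0 R own <= eps.
  apply: le_trans (prob_weight0_le T_large T_even S0) _.
  have -> : #|T|%:R / num_siblings R own = (2 * L)^-1 by rewrite -sigmaE invf_div.
  lra.
have e1 : expR (- L - L ^+ 2) <= eps.
  apply: le_trans (_ : expR (- L) <= _).
    by rewrite ler_expR gerBl sqr_ge0.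
  rewrite expRN; apply: le_trans (_ : (1 + L)^-1 <= _).
    by rewrite lef_pV2 ?posrE ?expR_gt0 ?expR_ge1Dx //; lra.
  have : 2 / (2 * L) = L^-1 by field; rewrite gt_eqF //; lra.
  have : (1 + L)^-1 <= L^-1 by rewrite lef_pV2 ?posrE //; lra.
  lra.
by rewrite ler_norml; apply/andP; split; lra.
Qed.

End Quantitative.

Local Open Scope classical_set_scope.
Local Open Scope ring_scope.

Theorem corollary1p5 (R : realType) (n : nat -> nat)
    (d : forall nu : nat, 'I_(n nu) -> nat)
    (n_ge1 : forall nu, (1 <= n nu)%N)
    (even_sum : forall nu, ~~ odd (\sum_(i < n nu) d nu i)%N)
    (N_infty : (fun nu => num_pairs (d nu)) @ \oo --> \oo)
    (max_small : (fun nu => (\max_(i < n nu) d nu i)%N%:R : R)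
       =o_\oo (fun nu => Num.sqrt (num_pairs (d nu))%:R : R)) :
  [/\ forall nu, (0 < num_pairs (d nu))%N ->
        Lambda R (d nu)
        = (\sum_(i < n nu) (d nu i)%:R ^+ 2) / (4 * (num_pairs (d nu))%:R)
          - 2^-1,
      (fun nu => prob_simple R (d nu))
        = (fun nu => expR (- Lambda R (d nu) - Lambda R (d nu) ^+ 2))
          +o_\oo (fun=> 1 : R)
    & (fun nu => prob_simple R (d nu))
        = (fun nu => expR (- 4^-1 * ((\sum_(i < n nu) (d nu i)%:R ^+ 2)
                                     / (2 * (num_pairs (d nu))%:R)) ^+ 2
                           + 4^-1))
          +o_\oo (fun=> 1 : R)].
Proof.
have LE nu := @Lambda_sqr R (n nu) (d nu) (even_sum nu).
have N_ge k : \forall nu \near \oo, (k <= num_pairs (d nu))%N.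
  exact: N_infty (nbhs_infty_ge k).
have approx (eps : R) : 0 < eps -> \forall nu \near \oo,
    `|prob_simple R (d nu) - expR (- Lambda R (d nu) - Lambda R (d nu) ^+ 2)| <= eps.
  move=> eps0; set C : R := 1100 * (1 + 4 / eps) ^+ 3.
  have C0 : 0 < C.
    apply: mulr_gt0; first by rewrite ltr0n.
    by rewrite exprn_gt0 // addr_gt0 // divr_gt0.
  (* With delta at most 1, delta ^ 2 is at most delta. *)
  pose delta := Num.min 1 (eps / C).
  have delta0 : 0 < delta by rewrite lt_min ltr01 divr_gt0.
  have delta2 : delta ^+ 2 <= eps / C.
    rewrite expr2; apply: le_trans (_ : 1 * delta <= _).
      by rewrite ler_wpM2r ?(ltW delta0) // ge_min lexx.
    by rewrite mul1r ge_min lexx orbT.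
  have small : \forall nu \near \oo, `|(\max_(i < n nu) d nu i)%N%:R : R| <=
      delta * `|Num.sqrt (num_pairs (d nu))%:R : R|.
    by move/eqoP: max_small; apply.
  near=> nu.
  have N7 : (7 <= num_pairs (d nu))%N by near: nu; exact: N_ge.
  have N0 : 0 < (num_pairs (d nu))%:R :> R by rewrite ltr0n; apply: leq_trans N7.
  have Dsmall : `|(\max_(i < n nu) d nu i)%N%:R : R| <=
      delta * `|Num.sqrt (num_pairs (d nu))%:R : R| by near: nu; exact: small.
  apply: prob_simple_approx => //.
    apply: le_trans (ltW (truncnS_gt (4 / eps))) _; rewrite ler_nat.
    by near: nu; exact: N_ge.
  rewrite -/C; set D : R := _%:R; set N : R := (num_pairs _)%:R.
  have D2 : D ^+ 2 <= delta ^+ 2 * N.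
    have -> : delta ^+ 2 * N = (delta * Num.sqrt N) ^+ 2.
      by rewrite exprMn sqr_sqrtr // ltW.
    rewrite lerXn2r ?nnegrE ?mulr_ge0 ?sqrtr_ge0 ?(ltW delta0) ?ler0n //.
    by move: Dsmall; rewrite -/D -/N !ger0_norm ?sqrtr_ge0 ?ler0n.
  have h1 : D ^+ 2 / (2 * N) <= delta ^+ 2.
    rewrite ler_pdivrMr ?mulr_gt0 //; apply: le_trans D2 _.
    rewrite ler_wpM2l ?exprn_ge0 ?(ltW delta0) //; move: N0; rewrite -/N; lra.
  apply: le_trans (ler_wpM2l (ltW C0) (le_trans h1 delta2)) _.
  by rewrite mulrC divfK ?gt_eqF.
split=> [nu /LE //||].
  apply/eqaddoP => eps eps0; have := approx eps eps0; apply: filter_app.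
  by near=> nu => h; rewrite normr1 mulr1.
apply/eqaddoP => eps eps0; have := approx eps eps0; apply: filter_app.
near=> nu; rewrite normr1 mulr1.
have N1 : (0 < num_pairs (d nu))%N by near: nu; exact: N_ge.
have expE : - Lambda R (d nu) - Lambda R (d nu) ^+ 2 =
    - 4^-1 * ((\sum_(i < n nu) (d nu i)%:R ^+ 2) / (2 * (num_pairs (d nu))%:R)) ^+ 2 + 4^-1.
  by rewrite (LE nu N1); field; rewrite pnatr_eq0 -lt0n.
by rewrite expE.
Unshelve. all: by end_near.
Qed.
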